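(* Let $p$ be a prime, $n\ge1$, $f,g\in\Phi_{\times}'(\mathbb{Q}_p^n)$, let $\rho$ be an automodel function on $\mathbb{Q}_p^*$, and let $\beta=(\beta_1,\dots,\beta_n)\in\mathbb{C}^n$, $|{-\beta}|=-(\beta_1+\cdots+\beta_n)$. Then $$f(x)\stackrel{\Phi_{\times}'}{\sim}g(x),\quad |x|_p\to\infty\quad\big(\rho(t)\big)$$ if and only if $$D^{\beta}_{\times}f(x)\stackrel{\Phi_{\times}'}{\sim}D^{\beta}_{\times}g(x),\quad|x|_p\to\infty\quad\big(|t|_p^{|-\beta|}\rho(t)\big).$$
   Context: $\mathbb{Q}_p$ has norm $|p|_p=p^{-1}$ and Haar measure $dx$ with $\int_{|x|_p\le1}dx=1$; $\mathbb{Q}_p^*=\mathbb{Q}_p\setminus\{0\}$; $B_0=\{x\in\mathbb{Q}_p:|x|_p\le1\}$. $\mathcal{D}(\mathbb{Q}_p^n)$ is the space of locally constant compactly supported functions $\mathbb{Q}_p^n\to\mathbb{C}$; $\mathcal{D}'(\mathbb{Q}_p^n)$ is the space of all linear functionals on it. Fourier transform: $F[\varphi](\xi)=\int_{\mathbb{Q}_p^n}\chi_p(\xi\cdot x)\varphi(x)\,d^nx$, with $\chi_p(\xi\cdot x)=e^{2\pi i\sum_j\{\xi_jx_j\}_p}$, $\{\cdot\}_p$ the $p$-adic fractional part. $\Psi_{\times}(\mathbb{Q}_p^n)=\{\psi\in\mathcal{D}(\mathbb{Q}_p^n):\psi(\xi_1,\dots,\xi_{j-1},0,\xi_{j+1},\dots,\xi_n)=0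 \text{ for all } \xi_i\ (i\neq j),\ j=1,\dots,n\}$; $\Phi_{\times}(\mathbb{Q}_p^n)=\{F[\psi]:\psi\in\Psi_{\times}(\mathbb{Q}_p^n)\}$ (Lizorkin test functions of the first kind), and $\Phi_{\times}'(\mathbb{Q}_p^n)$ is its dual (all linear functionals), with weak convergence. One-dimensional Riesz kernel $f_a\in\mathcal{D}'(\mathbb{Q}_p)$, $a\in\mathbb{C}$. Put $\mu_j=\frac{2\pi i}{\ln p}j$, $j\in\mathbb{Z}$, $\Gamma_p(a)=\frac{1-p^{a-1}}{1-p^{-a}}$. For $a\ne\mu_j,1+\mu_j$: $f_a(z)=|z|_p^{a-1}/\Gamma_p(a)$, where $$\langle|z|_p^{a-1},\varphi\rangle=\int_{B_0}|z|_p^{a-1}(\varphi(z)-\varphi(0))\,dz+\int_{\mathbb{Q}_p\setminus B_0}|z|_p^{a-1}\varphi(z)\,dz+\varphi(0)\frac{1-p^{-1}}{1-p^{-a}}.$$ For $a=\mu_j$: $f_a=\delta$. For $a=1+\mu_j$: $f_a(z)=-\frac{1-p^{-1}}{\log p}\log|z|_p$. For $\alpha\in\mathbb{C}^n$, $f_\alpha(x)=f_{\alpha_1}(x_1)\times\cdots\times f_{\alpha_n}(x_n)$ (direct product). The Vladimirov operator: $(D^{\alpha}_{\times}\phi)(x)=\langle f_{-\alpha}(\xi),\phi(x-\xi)\rangle$ for $\phi\in\Phi_{\times}$ (it maps $\Phi_\times$ to itself), and $\langle D^{\alpha}_{\times}f,\phi\rangle=\langle f,D^{\alpha}_{\times}\phi\rangle$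 for $f\in\Phi_{\times}'$, $\phi\in\Phi_\times$. An automodel function is a continuous $\rho:\mathbb{Q}_p^*\to\mathbb{C}$ such that for every $z\in\mathbb{Q}_p^*$ the limit $\lim_{|t|_p\to\infty}\rho(tz)/\rho(t)=C(z)$ exists, with $C$ a multiplicative character of $\mathbb{Q}_p$, $C(z)=\pi_\alpha(z)=|z|_p^{\alpha-1}\pi_1(z)$, where $\alpha\in\mathbb{C}$ and $\pi_1$ is a character with $|\pi_1|=1$, $\pi_1(p)=1$ (then $\rho$ has degree $\pi_\alpha$; in particular $\rho(t)\ne0$ for large $|t|_p$). For $t\in\mathbb{Q}_p^*$ and $f\in\Phi_{\times}'$, $f(tx)$ is defined by $\langle f(tx),\phi(x)\rangle=|t|_p^{-n}\langle f(x),\phi(x/t)\rangle$. The notation $f(x)\stackrel{\Phi_{\times}'}{\sim}g(x)$, $|x|_p\to\infty$ $(\rho(t))$ means: $g\not\equiv0$ in $\Phi_{\times}'$ and $\frac{f(tx)}{\rho(t)}\to g(x)$ in $\Phi_{\times}'(\mathbb{Q}_p^n)$ as $|t|_p\to\infty$, i.e. $\langle f(tx),\phi\rangle/\rho(t)\to\langle g,\phi\rangle$ for all $\phi\in\Phi_{\times}(\mathbb{Q}_p^n)$. *)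

(* Defs.v *)
From HB Require Import structures.
From mathcomp Require Import all_boot all_order all_algebra ring_quotient generic_quotient complex.
From mathcomp Require Import all_classical all_reals all_analysis.

Set Implicit Arguments.
Unset Strict Implicit.
Unset Printing Implicit Defensive.

Import Order.TTheory GRing.Theory Num.Theory numFieldNormedType.Exports.

Local Open Scope classical_set_scope.
Local Open Scope ring_scope.

Section PadicAbsoluteValueOnQ.
Variable p : nat.

Definition ratp_abs (x : rat) : rat :=
  if x == 0 then 0 else
  p%:R ^ ((logn p `|denq x|)%:Z - (logn p `|numq x|)%:Z).

Hypothesis p_pr : prime p.

Let p_gt0 : 0 < p%:R :> rat.
Proof. by rewrite ltr0n prime_gt0. Qed.

Let p_neq0 : p%:R != 0 :> rat.
Proof. by rewrite gt_eqF. Qed.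

Lemma ratp_abs0 : ratp_abs 0 = 0.
Proof. by rewrite /ratp_abs eqxx. Qed.

Lemma ratp_abs_gt0 x : (0 < ratp_abs x) = (x != 0).
Proof. by rewrite /ratp_abs; case: eqVneq => // _; rewrite exprz_gt0. Qed.

Lemma ratp_abs_ge0 x : 0 <= ratp_abs x.
Proof.
by have [->|x0] := eqVneq x 0; rewrite ?ratp_abs0// ltW// ratp_abs_gt0.
Qed.

Lemma ratp_abs_eq0 x : (ratp_abs x == 0) = (x == 0).
Proof. by rewrite eq_le ratp_abs_ge0 andbT leNgt ratp_abs_gt0 negbK. Qed.

Lemma ratp_abs_frac (a b : int) : a != 0 -> b != 0 ->
  ratp_abs (a%:~R / b%:~R) = p%:R ^ ((logn p `|b|)%:Z - (logn p `|a|)%:Z).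
Proof.
move=> a0 b0; set x := _ / _.
have x0 : x != 0 by rewrite mulf_neq0 ?invr_eq0 ?intr_eq0.
rewrite /ratp_abs (negPf x0); congr (_ ^ _).
have E : (numq x * b = a * denq x)%R.
  apply/eqP; rewrite -(eqr_int rat) !intrM; apply/eqP.
  have d0 : (denq x)%:~R != 0 :> rat by rewrite intr_eq0 denq_neq0.
  have b0' : b%:~R != 0 :> rat by rewrite intr_eq0.
  have : (numq x)%:~R / (denq x)%:~R = x by rewrite divq_num_den.
  move/(congr1 (fun t => t * (denq x)%:~R * b%:~R)).
  by rewrite mulfVK// => ->; rewrite /x mulrAC mulfVK.
have := congr1 (fun z : int => logn p `|z|) E.
rewrite !abszM !lognM ?absz_gt0 ?denq_neq0 ?numq_eq0// => E'.
by apply/eqP; rewrite subr_eq addrAC eq_sym subr_eq -!PoszD addnC E' addnC.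
Qed.

Lemma ratp_absM x y : ratp_abs (x * y) = ratp_abs x * ratp_abs y.
Proof.
have [->|x0] := eqVneq x 0; first by rewrite mul0r ratp_abs0 mul0r.
have [->|y0] := eqVneq y 0; first by rewrite mulr0 ratp_abs0 mulr0.
rewrite -{1}(divq_num_den x) -{1}(divq_num_den y) mulf_div -!intrM.
rewrite ratp_abs_frac ?mulf_neq0 ?numq_eq0 ?denq_neq0//.
rewrite !abszM !lognM ?absz_gt0 ?numq_eq0 ?denq_neq0//.
rewrite /ratp_abs (negPf x0) (negPf y0) -expfzDr//; congr (_ ^ _).
by rewrite !PoszD opprD addrACA.
Qed.

Lemma ratp_absN x : ratp_abs (- x) = ratp_abs x.
Proof. by rewrite /ratp_abs oppr_eq0 denqN numqN abszN. Qed.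

Lemma ratp_abs1 : ratp_abs 1 = 1.
Proof. by rewrite /ratp_abs oner_eq0/= logn1 subrr expr0z. Qed.

Lemma ratp_absV x : ratp_abs x^-1 = (ratp_abs x)^-1.
Proof.
have [->|x0] := eqVneq x 0; first by rewrite ratp_abs0 !invr0 ratp_abs0.
by apply: (mulfI (x := ratp_abs x)); rewrite ?ratp_abs_eq0//
  -ratp_absM !mulfV ?ratp_abs1 ?ratp_abs_eq0.
Qed.

Let ratp_abs_int (a : int) : a != 0 ->
  ratp_abs a%:~R = p%:R ^- logn p `|a|.
Proof.
move=> a0; have := ratp_abs_frac a0 (oner_neq0 _).
by rewrite divr1 => ->; rewrite logn1 sub0r -invr_expz.
Qed.

Let ratp_abs_int_le1 (a : int) : ratp_abs a%:~R <= 1.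
Proof.
have [->|a0] := eqVneq a 0; first by rewrite ratp_abs0.
rewrite ratp_abs_int//.
by rewrite invf_le1 ?exprn_gt0// exprn_ege1// ler1n prime_gt0.
Qed.

Lemma ratp_absD x y : ratp_abs (x + y) <= Num.max (ratp_abs x) (ratp_abs y).
Proof.
wlog xy : x y / ratp_abs x <= ratp_abs y => [H|].
  case/orP: (le_total (ratp_abs x) (ratp_abs y)) => [/H//|/H].
  by rewrite addrC maxC.
rewrite (max_idPr xy).
have [y0|y0] := eqVneq y 0.
  move: xy; rewrite y0 ratp_abs0 => x0; suff -> : x = 0 by rewrite addr0 ratp_abs0.
  by apply/eqP; rewrite -ratp_abs_eq0 eq_le x0 ratp_abs_ge0.
have -> : x + y = (x / y + 1) * y by rewrite mulrDl mul1r mulfVK.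
rewrite ratp_absM ger_pMl ?ratp_abs_gt0//.
move: xy; rewrite -[leRHS]mul1r -ler_pdivrMr ?ratp_abs_gt0// -ratp_absV -ratp_absM.
move: (x / y) => {x y y0} z z1.
have [->|z0] := eqVneq z 0; first by rewrite add0r ratp_abs1.
have d0 := denq_neq0 z.
have pd : ~~ (p %| `|denq z|)%N.
  apply/negP => pd; move: z1; rewrite leNgt => /negP; apply.
  have cop : coprime `|numq z| `|denq z| := coprime_num_den z.
  have pn : ~~ (p %| `|numq z|)%N.
    apply/negP => pn; have : (p %| gcdn `|numq z| `|denq z|)%N by rewrite dvdn_gcd pn.
    by rewrite (eqP cop) dvdn1 => /eqP p1; move: p_pr; rewrite p1.
  rewrite /ratp_abs (negPf z0) (lognE p `|numq z|) (negPf pn) !andbF subr0.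
  rewrite -?exprnP exprn_egt1 ?ltr1n ?prime_gt1//.
  by rewrite -lt0n logn_gt0 mem_primes p_pr absz_gt0 d0.
have -> : z + 1 = (numq z + denq z)%:~R / (denq z)%:~R.
  by rewrite intrD mulrDl divq_num_den mulfV// intr_eq0.
rewrite ratp_absM ratp_absV.
suff -> : ratp_abs (denq z)%:~R = 1 by rewrite invr1 mulr1.
by rewrite ratp_abs_int// lognE (negPf pd) !andbF expr0 invr1.
Qed.

Lemma ratp_absB x y : ratp_abs (x - y) <= Num.max (ratp_abs x) (ratp_abs y).
Proof. by rewrite -(ratp_absN y) ratp_absD. Qed.

Lemma ratp_abs_eq x y : ratp_abs (x - y) < ratp_abs y ->
  ratp_abs x = ratp_abs y.
Proof.
move=> xy; apply/eqP; rewrite eq_le; apply/andP; split.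
  by have := ratp_absD (x - y) y; rewrite subrK (max_idPr (ltW xy)).
rewrite leNgt; apply/negP => yx.
have := ratp_absB x (x - y); rewrite opprB addrC subrK.
by rewrite leNgt gt_max yx xy.
Qed.

Lemma ratp_abs_p : ratp_abs p%:R = p%:R^-1.
Proof.
have p0 : p%:Z != 0 by rewrite eqz_nat -lt0n prime_gt0.
by rewrite -[X in ratp_abs X]/(p%:Z%:~R) ratp_abs_int//= logn_prime// eqxx expr1.
Qed.

End PadicAbsoluteValueOnQ.

(* Q_p is the ring of p-adic Cauchy sequences of rationals modulo the ideal
   of null sequences. *)
Section PadicCauchySequences.
Variables (p : nat) (p_pr : prime p).
Local Notation absp := (ratp_abs p).

(* p_prime is a phantom argument: the subring structure depends on it. *)
Definition padic_cauchy (p_prime : prime p) : {pred nat -> rat} :=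
  fun u => `[< forall e : rat, 0 < e -> exists N : nat, forall m n : nat,
    (N <= m)%N -> (N <= n)%N -> absp (u m - u n) < e >].

Lemma padic_cauchyP u :
  reflect (forall e : rat, 0 < e -> exists N : nat, forall m n : nat,
    (N <= m)%N -> (N <= n)%N -> absp (u m - u n) < e) (u \in padic_cauchy p_pr).
Proof. exact: asboolP. Qed.

Lemma padic_cauchy_bounded u : u \in padic_cauchy p_pr ->
  exists2 M, 0 < M & forall n, absp (u n) <= M.
Proof.
move/padic_cauchyP => /(_ 1 ltr01)[N uN].
have [M0 M0P] : exists M0, forall n, (n < N)%N -> absp (u n) <= M0.
  elim: N {uN} => [|N [M IH]]; first by exists 0.
  exists (Num.max M (absp (u N))) => n; rewrite ltnS leq_eqVlt le_max.
  by case/predU1P => [->|/IH ->//]; rewrite lexx orbT.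
exists (Num.max 1 (Num.max M0 (absp (u N)))); first by rewrite lt_max ltr01.
move=> n; rewrite !le_max; case: (ltnP n N) => [/M0P ->|Nn]; first by rewrite orbT.
have := ratp_absD p_pr (u n - u N) (u N); rewrite subrK le_max => /orP[|->].
  by move/le_trans => ->//; apply/ltW/uN.
by rewrite !orbT.
Qed.

Lemma padic_cauchy_subring : subring_closed (padic_cauchy p_pr).
Proof.
split=> [|u v /padic_cauchyP cu /padic_cauchyP cv|u v cu cv]; apply/padic_cauchyP.
- by move=> e e0; exists 0%N => m n _ _; rewrite subrr ratp_abs0.
- move=> e e0; have [N uN] := cu _ e0; have [M vM] := cv _ e0.
  exists (maxn N M) => m n; rewrite !geq_max => /andP[Nm Mm] /andP[Nn Mn].
  have -> : (u - v) m - (u - v) n = (u m - u n) - (v m - v n).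
    rewrite -[(u - v) m]/(u m - v m) -[(u - v) n]/(u n - v n).
    by rewrite !opprD !opprK addrACA.
  by rewrite (le_lt_trans (ratp_absB p_pr _ _))// gt_max uN ?vM.
- have [A A0 uA] := padic_cauchy_bounded cu.
  have [B B0 vB] := padic_cauchy_bounded cv.
  move/padic_cauchyP : cu => cu; move/padic_cauchyP : cv => cv.
  move=> e e0; have [N uN] := cu _ (divr_gt0 e0 B0).
  have [M vM] := cv _ (divr_gt0 e0 A0).
  exists (maxn N M) => m n; rewrite !geq_max => /andP[Nm Mm] /andP[Nn Mn].
  have -> : (u * v) m - (u * v) n = (u m - u n) * v m + u n * (v m - v n).
    rewrite -[(u * v) m]/(u m * v m) -[(u * v) n]/(u n * v n).
    by rewrite mulrBl mulrBr addrA subrK.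
  rewrite (le_lt_trans (ratp_absD p_pr _ _))// gt_max !ratp_absM//.
  apply/andP; split.
    rewrite (le_lt_trans (ler_wpM2l (ratp_abs_ge0 p_pr _) (vB m)))//.
    by rewrite -ltr_pdivlMr//; exact: uN.
  rewrite (le_lt_trans (ler_wpM2r (ratp_abs_ge0 p_pr _) (uA n)))//.
  by rewrite mulrC -ltr_pdivlMr//; apply: vM.
Qed.

HB.instance Definition _ :=
  GRing.isSubringClosed.Build (nat -> rat) (padic_cauchy p_pr)
    padic_cauchy_subring.

End PadicCauchySequences.

Record padic_cseq (p : nat) (p_pr : prime p) := PadicCseq {
  padic_cseq_val :> nat -> rat;
  _ : padic_cseq_val \in padic_cauchy p_pr }.

Section PadicCauchyRing.
Variables (p : nat) (p_pr : prime p).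
HB.instance Definition _ := [isSub for @padic_cseq_val p p_pr].
HB.instance Definition _ := [Choice of padic_cseq p_pr by <:].
HB.instance Definition _ :=
  [SubChoice_isSubComNzRing of padic_cseq p_pr by <:].
End PadicCauchyRing.

Section PadicNullSequences.
Variables (p : nat) (p_pr : prime p).
Local Notation absp := (ratp_abs p).

Definition padic_null : {pred padic_cseq p_pr} :=
  fun u => `[< forall e : rat, 0 < e -> exists N : nat, forall n : nat,
    (N <= n)%N -> absp (u n) < e >].

Lemma padic_nullP (u : padic_cseq p_pr) :
  reflect (forall e : rat, 0 < e -> exists N : nat, forall n : nat,
    (N <= n)%N -> absp (u n) < e) (u \in padic_null).
Proof. exact: asboolP. Qed.

Lemma padic_null_idealr : idealr_closed padic_null.
Proof.
split=> [||a u v /padic_nullP cu /padic_nullP cv].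
- by apply/padic_nullP => e e0; exists 0%N => n _; rewrite ratp_abs0.
- apply/negP => /padic_nullP/(_ 1 ltr01)[N /(_ N (leqnn _))].
  by rewrite ratp_abs1// ltxx.
- apply/padic_nullP => e e0; have [A A0 aA] := padic_cauchy_bounded (valP a).
  have [N uN] := cu _ (divr_gt0 e0 A0); have [M vM] := cv _ e0.
  exists (maxn N M) => n; rewrite geq_max => /andP[Nn Mn].
  rewrite -[_ n]/(a n * u n + v n) (le_lt_trans (ratp_absD p_pr _ _))//.
  rewrite gt_max vM// andbT ratp_absM//.
  rewrite (le_lt_trans (ler_wpM2r (ratp_abs_ge0 p_pr _) (aA n)))//.
  by rewrite mulrC -ltr_pdivlMr//; apply: uN.
Qed.

HB.instance Definition _ :=
  isIdealr.Build (padic_cseq p_pr) padic_null padic_null_idealr.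

End PadicNullSequences.
Arguments padic_null {p} p_pr.

Definition padic (p : nat) (p_pr : prime p) : Type :=
  {ideal_quot (padic_null p_pr)}.

Section PadicField.
Variables (p : nat) (p_pr : prime p).
Local Notation absp := (ratp_abs p).
Local Notation Qp := (padic p_pr).
Local Open Scope quotient_scope.

HB.instance Definition _ := GRing.ComNzRing.on Qp.

Definition padic_pi (u : padic_cseq p_pr) : Qp :=
  \pi_({ideal_quot (padic_null p_pr)}) u.

Lemma padic_pi_is_zmod_morphism : zmod_morphism padic_pi.
Proof. exact: rmorphB. Qed.

Lemma padic_pi_is_monoid_morphism : monoid_morphism padic_pi.
Proof. by split; [exact: rmorph1|exact: rmorphM]. Qed.

HB.instance Definition _ := GRing.isZmodMorphism.Build (padic_cseq p_pr) Qp
  padic_pi padic_pi_is_zmod_morphism.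
HB.instance Definition _ := GRing.isMonoidMorphism.Build (padic_cseq p_pr) Qp
  padic_pi padic_pi_is_monoid_morphism.

Lemma padic_repr (x : Qp) : exists u, x = padic_pi u.
Proof. by exists (repr (x : {ideal_quot _})); rewrite /padic_pi reprK. Qed.

Lemma padic_pi_eq0 u : (padic_pi u == 0) = (u \in padic_null p_pr).
Proof.
by rewrite -[in RHS](subr0 u) Quotient.idealrBE -(rmorph0 padic_pi).
Qed.

Lemma padic_cauchy_abs (u : padic_cseq p_pr) : u \notin padic_null p_pr ->
  exists2 r, 0 < r & exists N : nat, forall n, (N <= n)%N -> absp (u n) = r.
Proof.
move=> u0.
have [e e0 eu] : exists2 e, 0 < e &
    forall N : nat, exists2 n, (N <= n)%N & e <= absp (u n).
  apply: contrapT => /forall2NP H; move/negP : u0; apply; apply/padic_nullP.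
  move=> e e0; have [//|/existsNP[N /forall2NP uN]] := H e.
  exists N => n Nn; rewrite ltNge; apply/negP => en.
  by have [] := uN n.
have /padic_cauchyP/(_ _ e0)[N uN] := valP u.
have [M NM eM] := eu N.
exists (absp (u M)); first exact: lt_le_trans eM.
exists N => n Nn; apply: ratp_abs_eq => //.
by apply: lt_le_trans eM; exact: uN.
Qed.

Lemma padic_inv_exists (x : Qp) : x != 0 -> exists y, y * x = 1.
Proof.
have [u ->] := padic_repr x; rewrite padic_pi_eq0 => /padic_cauchy_abs.
move=> [r r0 [N uN]]; pose v n := if (n < N)%N then 0 else (u n)^-1.
have un0 n : (N <= n)%N -> u n != 0.
  by move=> /uN ur; rewrite -(ratp_abs_eq0 p_pr) ur gt_eqF.
have cv : v \in padic_cauchy p_pr.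
  have /padic_cauchyP cu := valP u; apply/padic_cauchyP => e e0.
  have [M uM] := cu _ (mulr_gt0 e0 (mulr_gt0 r0 r0)).
  exists (maxn N M) => m n; rewrite !geq_max => /andP[Nm Mm] /andP[Nn Mn].
  rewrite /v !ltnNge Nm Nn/=.
  have -> : (u m)^-1 - (u n)^-1 = (u n - u m) / (u m * u n).
    by rewrite invfM mulrBl mulrCA mulfV ?un0// mulr1 mulVKf ?un0.
  rewrite ratp_absM// ratp_absV// ratp_absM// !uN// ltr_pdivrMr ?mulr_gt0//.
  exact: uM.
exists (padic_pi (PadicCseq cv)); apply/eqP.
rewrite -subr_eq0 -(rmorph1 padic_pi) -rmorphM -rmorphB padic_pi_eq0.
apply/padic_nullP => e e0; exists N => n Nn.
by rewrite -[X in absp X]/(v n * u n - 1) /v ltnNge Nn/= mulVf ?un0//.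
Qed.

Definition padic_inv (x : Qp) : Qp :=
  if x == 0 then 0 else xget 0 [set y | y * x = 1].

Lemma padic_mulVf (x : Qp) : x != 0 -> padic_inv x * x = 1.
Proof.
move=> x0; rewrite /padic_inv (negPf x0); case: xgetP => [y _ //|H].
by have [y yx] := padic_inv_exists x0; have := H y.
Qed.

Lemma padic_invr0 : padic_inv 0 = 0.
Proof. by rewrite /padic_inv eqxx. Qed.

HB.instance Definition _ :=
  GRing.ComNzRing_isField.Build Qp padic_mulVf padic_invr0.

Definition padic_abs (x : Qp) : rat :=
  lim (((absp (repr (x : {ideal_quot (padic_null p_pr)}) n)) : rat^o)
    @[n --> \oo]).


Let cvg_abs0 (u : padic_cseq p_pr) : u \in padic_null p_pr ->
  (absp (u n) : rat^o) @[n --> \oo] --> (0 : rat^o).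
Proof.
move=> /padic_nullP u0; apply/cvgrPdist_lt => e /u0[N uN].
exists N => // n /= /uN; rewrite sub0r normrN ger0_norm//.
exact: ratp_abs_ge0.
Qed.

Let cvg_abs (u : padic_cseq p_pr) r N : (forall n, (N <= n)%N -> absp (u n) = r) ->
  (absp (u n) : rat^o) @[n --> \oo] --> (r : rat^o).
Proof. by move=> uN; apply: cvg_near_cst; exists N. Qed.

Lemma padic_cvg_abs (u : padic_cseq p_pr) :
  (absp (u n) : rat^o) @[n --> \oo] --> (padic_abs (padic_pi u) : rat^o).
Proof.
rewrite /padic_abs; set v := repr _.
have piv : padic_pi v = padic_pi u by exact: reprK.
have vu : v - u \in padic_null p_pr.
  by rewrite -padic_pi_eq0 rmorphB/= piv subrr.
have [u0|u0] := boolP (u \in padic_null p_pr).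
  have v0 : v \in padic_null p_pr by rewrite -padic_pi_eq0 piv padic_pi_eq0.
  by rewrite (cvg_lim _ (cvg_abs0 v0))//; exact: cvg_abs0.
have [r r0 [N uN]] := padic_cauchy_abs u0.
have [M vM] := padic_nullP _ vu _ r0.
have vr n : (maxn N M <= n)%N -> absp (v n) = r.
  by rewrite geq_max => /andP[/uN ur /vM]; rewrite -ur => /ratp_abs_eq ->.
by rewrite (cvg_lim _ (cvg_abs vr))//; exact: cvg_abs uN.
Qed.

Arguments padic_cvg_abs u : clear implicits.

Lemma padic_abs_pi (u : padic_cseq p_pr) (l : rat) :
  (absp (u n) : rat^o) @[n --> \oo] --> (l : rat^o) ->
  padic_abs (padic_pi u) = l.
Proof.
by move=> ul; rewrite -(cvg_lim _ (padic_cvg_abs u))// (cvg_lim _ ul).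
Qed.

Lemma padic_abs_le (u : padic_cseq p_pr) (M : rat) :
  (\forall n \near \oo, absp (u n) <= M) -> padic_abs (padic_pi u) <= M.
Proof.
move=> uM; rewrite -(cvg_lim _ (padic_cvg_abs u))//; apply: limr_le => //.
by apply/cvg_ex; exists (padic_abs (padic_pi u)); exact: padic_cvg_abs.
Qed.

Lemma padic_abs_ge0 (x : Qp) : 0 <= padic_abs x.
Proof.
have [u ->] := padic_repr x; have := padic_cvg_abs u.
move/(cvg_lim _) => <-//; apply: limr_ge.
  by apply/cvg_ex; exists (padic_abs (padic_pi u)); exact: padic_cvg_abs.
by near=> n; exact: ratp_abs_ge0.
Unshelve. all: by end_near. Qed.

Lemma padic_abs_eq0 (x : Qp) : (padic_abs x == 0) = (x == 0).
Proof.
have [u ->] := padic_repr x; rewrite padic_pi_eq0.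
have [u0|u0] := boolP (u \in padic_null p_pr).
  by rewrite (padic_abs_pi (cvg_abs0 u0)) eqxx.
have [r r0 [N uN]] := padic_cauchy_abs u0.
by rewrite (padic_abs_pi (cvg_abs uN)) gt_eqF.
Qed.

Lemma padic_abs0 : padic_abs 0 = 0.
Proof. by apply/eqP; rewrite padic_abs_eq0. Qed.

Lemma padic_absN (x : Qp) : padic_abs (- x) = padic_abs x.
Proof.
have [u ->] := padic_repr x; rewrite -rmorphN.
apply: padic_abs_pi.
rewrite (_ : (fun n => absp ((- u) n)) = (fun n => absp (u n))).
  exact: padic_cvg_abs.
by apply/funext => n; rewrite -[X in absp X]/(- u n) ratp_absN.
Qed.

Lemma padic_absM (x y : Qp) : padic_abs (x * y) = padic_abs x * padic_abs y.
Proof.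
have [u ->] := padic_repr x; have [v ->] := padic_repr y; rewrite -rmorphM.
apply: padic_abs_pi.
rewrite (_ : (fun n => absp ((u * v) n)) =
    (fun n => absp (u n)) \* (fun n => absp (v n))).
  by apply: cvgM; exact: padic_cvg_abs.
by apply/funext => n; rewrite -[X in absp X]/(u n * v n) ratp_absM.
Qed.

Lemma padic_absD (x y : Qp) :
  padic_abs (x + y) <= Num.max (padic_abs x) (padic_abs y).
Proof.
have [u ->] := padic_repr x; have [v ->] := padic_repr y.
set M := Num.max _ _; apply/ler_addgt0Pr => e e0.
have uM w : padic_abs (padic_pi w) <= M ->
    \forall n \near \oo, absp (w n) <= M + e.
  move=> wM; have /cvgrPdist_lt/(_ _ e0) := padic_cvg_abs w.
  apply: filterS => n; rewrite ltr_distlC => /andP[_ /ltW/le_trans]; apply.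
  by rewrite lerD2r.
rewrite -rmorphD; apply: padic_abs_le.
have uM' := uM u; have vM' := uM v.
near=> n; rewrite -[X in absp X]/(u n + v n).
rewrite (le_trans (ratp_absD p_pr _ _))// ge_max; apply/andP; split; near: n.
  by apply: uM'; rewrite le_max lexx.
by apply: vM'; rewrite le_max lexx orbT.
Unshelve. all: by end_near. Qed.

Definition padic_dist (x y : Qp) : rat := padic_abs (x - y).

Lemma padic_distxx (x : Qp) : padic_dist x x = 0.
Proof. by rewrite /padic_dist subrr padic_abs0. Qed.

Lemma padic_dist_positivity (x y : Qp) : padic_dist x y = 0 -> x = y.
Proof. by move/eqP; rewrite padic_abs_eq0 subr_eq0 => /eqP. Qed.

Lemma padic_dist_sym (x y : Qp) : padic_dist x y = padic_dist y x.
Proof. by rewrite /padic_dist -opprB padic_absN. Qed.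

Lemma padic_dist_triangle (y x z : Qp) :
  padic_dist x z <= padic_dist x y + padic_dist y z.
Proof.
rewrite /padic_dist -(subrK y x) -addrA subrK.
rewrite (le_trans (padic_absD _ _))// ge_max.
by rewrite lerDl lerDr !padic_abs_ge0.
Qed.

HB.instance Definition _ := isPointed.Build Qp 0.
HB.instance Definition _ := isMetric.Build rat Qp
  padic_distxx padic_dist_positivity padic_dist_sym padic_dist_triangle.

HB.instance Definition _ :=
  Measurable.copy Qp (g_sigma_algebraType (@open Qp)).

Lemma padic_cauchy_cst (q : rat) : (fun=> q) \in padic_cauchy p_pr.
Proof.
by apply/padic_cauchyP => e e0; exists 0%N => m n _ _; rewrite subrr ratp_abs0.
Qed.

Definition padic_of_rat (q : rat) : Qp := padic_pi (PadicCseq (padic_cauchy_cst q)).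

Lemma padic_of_rat_is_zmod_morphism : zmod_morphism padic_of_rat.
Proof.
by move=> q r; rewrite /padic_of_rat -rmorphB; congr (padic_pi _); apply/val_inj.
Qed.

Lemma padic_of_rat_is_monoid_morphism : monoid_morphism padic_of_rat.
Proof.
split=> [|q r]; rewrite /padic_of_rat.
  by rewrite -(rmorph1 padic_pi); congr (padic_pi _); apply/val_inj.
by rewrite -rmorphM; congr (padic_pi _); apply/val_inj.
Qed.

HB.instance Definition _ := GRing.isZmodMorphism.Build rat Qp
  padic_of_rat padic_of_rat_is_zmod_morphism.
HB.instance Definition _ := GRing.isMonoidMorphism.Build rat Qp
  padic_of_rat padic_of_rat_is_monoid_morphism.

Lemma padic_of_ratE : padic_of_rat =1 ratr.
Proof. exact: fmorph_eq_rat. Qed.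

Lemma padic_abs_ratr (q : rat) : padic_abs (ratr q) = absp q.
Proof.
by rewrite -padic_of_ratE; apply: padic_abs_pi; exact: (@cvg_abs _ _ 0%N).
Qed.

Lemma padic_abs_p : padic_abs p%:R = p%:R^-1.
Proof. by rewrite -(ratr_nat Qp p) padic_abs_ratr ratp_abs_p. Qed.

Lemma padic_dense_rat (x : Qp) (e : rat) : 0 < e ->
  exists q : rat, padic_abs (x - ratr q) < e.
Proof.
have [u ->] := padic_repr x => e0.
have e20 : 0 < e / 2 by rewrite divr_gt0.
have /padic_cauchyP/(_ _ e20)[N uN] := valP u.
exists (u N); rewrite -padic_of_ratE -rmorphB.
rewrite (le_lt_trans (y := e / 2))// ?gtr_pMr ?invf_lt1 ?ltr1n//.
by apply: padic_abs_le; exists N => // n /= Nn; apply/ltW/uN.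
Qed.

End PadicField.

Section ComplexExponential.
Variable R : realType.
Local Open Scope complex_scope.

Definition cexp (z : R[i]) : R[i] :=
  (expR (complex.Re z))%:C * (cos (complex.Im z) +i* sin (complex.Im z)).

(* x ^ a = exp (a ln x), meaningful for 0 < x only *)
Definition cpow (x : R) (a : R[i]) : R[i] := cexp (a * (ln x)%:C).

End ComplexExponential.

Section PadicFunctions.
Variables (R : realType) (p : nat) (p_pr : prime p).
Local Notation Qp := (padic p_pr).
Local Notation C := (R[i]).
Local Open Scope complex_scope.

Definition padic_norm (x : Qp) : R := ratr (padic_abs x).

(* The fractional part of x is the unique r in Z[1/p] such that 0 <= r < 1
   and x - r is a p-adic integer. *)
Definition padic_frac (x : Qp) : rat :=
  xget 0 [set r : rat | [/\ 0 <= r < 1,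
    exists m k : nat, r = m%:R / p%:R ^+ k & padic_abs (x - ratr r) <= 1]].

Definition padic_infty : set_system Qp :=
  filter_from [set: rat] (fun M => [set t | M < padic_abs t]).

Definition haar_measure (mu : {measure set Qp -> \bar R}) : Prop :=
  (forall (a : Qp) (A : set Qp), measurable A ->
    mu [set a + x | x in A] = mu A) /\
  mu [set x | padic_norm x <= 1] = 1%E.

Definition cintegral (mu : {measure set Qp -> \bar R}) (D : set Qp)
    (f : Qp -> C) : C :=
  (\int[mu]_(x in D) complex.Re (f x)) +i* (\int[mu]_(x in D) complex.Im (f x)).

Section SeveralVariables.
Variable n : nat.
Local Notation Qpn := 'rV[Qp]_n.

Definition set_coord (x : Qpn) (j : 'I_n) (z : Qp) : Qpn :=
  \row_i (if i == j then z else x 0 i).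

(* <T_1(x_1) x ... x T_n(x_n), phi> =
   <T_1(x_1), <T_2(x_2), ... <T_n(x_n), phi(x_1, ..., x_n)> ...>>;
   the base point 0 is irrelevant, since all its coordinates get replaced. *)
Definition direct_product (T : 'I_n -> (Qp -> C) -> C) (phi : Qpn -> C) : C :=
  foldr (fun j (Phi : Qpn -> C) x => T j (fun z => Phi (set_coord x j z)))
    phi (enum 'I_n) 0.

(* d^n x = dx_1 ... dx_n *)
Definition cintegraln (mu : {measure set Qp -> \bar R}) (f : Qpn -> C) : C :=
  direct_product (fun=> cintegral mu setT) f.

Definition additive_char (xi x : Qpn) : C :=
  cexp (0 +i* (2 * pi * \sum_j ratr (padic_frac (xi 0 j * x 0 j)))).

Definition fourier (mu : {measure set Qp -> \bar R}) (psi : Qpn -> C) :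
    Qpn -> C :=
  fun xi => cintegraln mu (fun x => additive_char xi x * psi x).

Definition test_function (phi : Qpn -> C) : Prop :=
  (forall x, \forall y \near x, phi y = phi x) /\
  compact (closure [set x | phi x != 0]).

Definition lizorkin_psi (psi : Qpn -> C) : Prop :=
  test_function psi /\ forall (j : 'I_n) (x : Qpn), x 0 j = 0 -> psi x = 0.

Definition lizorkin_phi (mu : {measure set Qp -> \bar R}) (phi : Qpn -> C) :
    Prop :=
  exists2 psi, lizorkin_psi psi & phi = fourier mu psi.

(* An element of the dual of the Lizorkin space is represented by a functional
   of which only the values on that space are ever used. *)
Definition lizorkin_dual (mu : {measure set Qp -> \bar R})
    (f : (Qpn -> C) -> C) : Prop :=
  forall (c : C) (phi1 phi2 : Qpn -> C),
    lizorkin_phi mu phi1 -> lizorkin_phi mu phi2 ->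
    f (fun x => c * phi1 x + phi2 x) = c * f phi1 + f phi2.

End SeveralVariables.

Definition mu_period (j : int) : C := 0 +i* (2 * pi / ln p%:R * j%:~R).

Definition Gammap (a : C) : C :=
  (1 - cpow p%:R (a - 1)) / (1 - cpow p%:R (- a)).

(* <|z|_p^(a-1), phi> *)
Definition power_functional (mu : {measure set Qp -> \bar R}) (a : C)
    (phi : Qp -> C) : C :=
  cintegral mu [set z | padic_norm z <= 1]
    (fun z => cpow (padic_norm z) (a - 1) * (phi z - phi 0)) +
  cintegral mu (~` [set z | padic_norm z <= 1])
    (fun z => cpow (padic_norm z) (a - 1) * phi z) +
  phi 0 * ((1 - p%:R^-1) / (1 - cpow p%:R (- a))).

Definition riesz_kernel (mu : {measure set Qp -> \bar R}) (a : C)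
    (phi : Qp -> C) : C :=
  if `[< exists j, a = mu_period j >] then phi 0
  else if `[< exists j, a = 1 + mu_period j >] then
    cintegral mu setT
      (fun z => (- ((1 - p%:R^-1) / ln p%:R * ln (padic_norm z)))%:C * phi z)
  else power_functional mu a phi / Gammap a.

Definition vladimirov (mu : {measure set Qp -> \bar R}) n (alpha : 'I_n -> C)
    (phi : 'rV[Qp]_n -> C) : 'rV[Qp]_n -> C :=
  fun x => direct_product (fun j => riesz_kernel mu (- alpha j))
    (fun xi => phi (x - xi)).

Definition dual_vladimirov (mu : {measure set Qp -> \bar R}) n
    (alpha : 'I_n -> C) (f : ('rV[Qp]_n -> C) -> C) :
    ('rV[Qp]_n -> C) -> C :=
  fun phi => f (vladimirov mu alpha phi).

Definition dilation n (t : Qp) (f : ('rV[Qp]_n -> C) -> C) :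
    ('rV[Qp]_n -> C) -> C :=
  fun phi => (padic_norm t ^- n)%:C * f (fun x => phi (t^-1 *: x)).

Definition normalized_character (pi1 : Qp -> C) : Prop :=
  [/\ forall x, x != 0 -> {for x, continuous (pi1 : Qp -> C^o)},
      forall x y, x != 0 -> y != 0 -> pi1 (x * y) = pi1 x * pi1 y,
      forall x, x != 0 -> `|pi1 x| = 1
    & pi1 p%:R = 1].

(* The value of rho at 0 is irrelevant. *)
Definition automodel (rho : Qp -> C) : Prop :=
  (forall x, x != 0 -> {for x, continuous (rho : Qp -> C^o)}) /\
  exists (alpha : C) (pi1 : Qp -> C), normalized_character pi1 /\
    forall z, z != 0 ->
      (rho (t * z) / rho t : C^o) @[t --> padic_infty] -->
      (cpow (padic_norm z) (alpha - 1) * pi1 z : C^o).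

Definition quasi_asymptotics (mu : {measure set Qp -> \bar R}) n
    (f g : ('rV[Qp]_n -> C) -> C) (rho : Qp -> C) : Prop :=
  (exists2 phi, lizorkin_phi mu phi & g phi != 0) /\
  forall phi, lizorkin_phi mu phi ->
    (dilation t f phi / rho t : C^o) @[t --> padic_infty] --> (g phi : C^o).

End PadicFunctions.

(* Main.v *)
(* The operator acts on Fourier transforms of Lizorkin functions as the
   multiplier prod_j |xi_j|^(beta_j). Hence it is a bijection of the Lizorkin
   space onto itself and it commutes with the dilation x |-> x / t up to the
   factor |t|^(- sum_j beta_j), so that the quotient defining the second
   asymptotics at phi is the one defining the first at D^beta phi.

   By compactness a Lizorkin function psi is a finite combination of
   indicators of boxes b + (p^N Z_p)^n that avoid the coordinate hyperplanes,
   and |.|^beta is constant on such boxes. Multilinearity of the direct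
   products leaves one identity in one variable: if |b| > p^(-N), then f_a
   applied to z |-> chi(b z) 1_{|z - x| <= p^N} equals |b|^(-a) 1_{|x| <= p^N}. *)
Require Import Defs.
From HB Require Import structures.
From mathcomp Require Import all_boot all_order all_algebra complex.
From mathcomp Require Import all_classical all_reals all_analysis.
From mathcomp Require Import measurable_realfun ring lra zify.
Import Order.TTheory GRing.Theory Num.Theory numFieldNormedType.Exports.
Set Implicit Arguments.
Unset Strict Implicit.
Unset Printing Implicit Defensive.
Local Open Scope classical_set_scope.
Local Open Scope ring_scope.

(** * The complex exponential *)

(** The one-variable identity rests on where the frequency sits: if |b| = p^(-k), the character z
    |-> chi(b z) is trivial on the ball of radius p^k and has integral 0 over every larger ball
    centred at 0. A radial density h is constant on spheres, so enlarging the ball from p^k to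
    p^(k+1) changes the value by h(p^(k+1)) (0 - p^k), and further enlargements change nothing. For
    h(r) = r^(a-1) the ball of radius p^k has regularized value p^(k a) (1 - 1/p) / (1 - p^(-a));
    subtracting p^(k a) p^(a-1) leaves p^(k a) Gamma_p(a), which explains the normalization of f_a.
    The obstacle is the exceptional exponents, where f_a is delta or a logarithm and Gamma_p has a
    pole or a zero. The argument is therefore run for an arbitrary density h and an arbitrary value
    c0 on the unit ball, under a recursion tying them to the values expected on waves; each of the
    three kinds of kernel then only has to satisfy that recursion. *)

Section Cexp.
Variable R : realType.
Local Open Scope complex_scope.
Implicit Types (z w : R[i]) (x y : R).

Lemma cexpD z w : cexp (z + w) = cexp z * cexp w.
Proof.
case: z w => [a b] [c d]; rewrite /cexp; simpc; rewrite expRD cosD sinD.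
by congr (_ +i* _); ring.
Qed.

Lemma cexp0 : cexp 0 = 1 :> R[i].
Proof. by rewrite /cexp /= expR0 cos0 sin0 mul1r. Qed.

Lemma cexp_neq0 z : cexp z != 0.
Proof.
apply/eqP => z0; have := cexpD z (- z).
by rewrite subrr cexp0 z0 mul0r; apply/eqP; rewrite oner_eq0.
Qed.

Lemma cexpN z : cexp (- z) = (cexp z)^-1.
Proof.
apply: (mulfI (cexp_neq0 z)); rewrite -cexpD subrr cexp0 mulfV//.
exact: cexp_neq0.
Qed.

Lemma cexp_sum (I : Type) (r : seq I) (F : I -> R[i]) :
  cexp (\sum_(i <- r) F i) = \prod_(i <- r) cexp (F i).
Proof. by apply: (big_morph _ cexpD cexp0). Qed.

Lemma cexpMn z n : cexp (z *+ n) = cexp z ^+ n.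
Proof. by elim: n => [|n IH]; rewrite ?cexp0 // mulrS cexpD IH exprS. Qed.

Lemma cexpMz z k : cexp (z *~ k) = cexp z ^ k.
Proof.
case: k => n; first exact: cexpMn.
by rewrite -[z *~ _]/(- (z *+ n.+1)) cexpN cexpMn.
Qed.

(** Subtracting the multiple of 2 pi given by a floor leaves a number in [0, 2 pi), where
    injectivity of cosine on [0, pi] decides. *)
Lemma cos_eq1 y : cos y = 1 -> exists k : int, y = 2 * pi * k%:~R.
Proof.
move=> cy; have pi0 := pi_gt0 R; set k := Num.floor (y / (2 * pi)).
have k1 := floor_le (y / (2 * pi)); have k2 := floorD1_gt (y / (2 * pi)).
have {}k1 : 0 <= y - 2 * pi * k%:~R.
  by rewrite subr_ge0 mulrC -ler_pdivlMr ?mulr_gt0.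
have {}k2 : y - 2 * pi * k%:~R < 2 * pi.
  move: k2; rewrite ltr_pdivrMr ?mulr_gt0// -/k intrD mulrDl mul1r => h.
  by rewrite ltrBlDl mulrC.
have ck : cos (y - 2 * pi * k%:~R) = 1.
  have H (u : R) (n : nat) : cos (u + 2 * pi * n%:R) = cos u.
    have -> : u + 2 * pi * n%:R = u + (pi *+ 2) *+ n.
      by rewrite -(mulr_natr (pi *+ 2) n) -(mulr_natl pi 2).
    by rewrite periodicn//; exact: cosD2pi.
  rewrite -[RHS]cy; case: (k) => n.
    by rewrite -[in RHS](subrK (2 * pi * n%:R) y) H.
  by rewrite NegzE mulrNz mulrN opprK H.
exists k; apply/eqP; rewrite -subr_eq0; apply/eqP.
move: (y - _) k1 k2 ck => u u0 u2 cu.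
have [upi|upi] := leP u pi.
  by apply: (@cos_inj R); [rewrite in_itv/= u0|rewrite in_itv/= lexx ltW|rewrite cos0].
(* In the second half of the period, reflection brings u back to [0, pi] and would force u = 2 pi,
   against the strict bound. *)
have : 2 * pi - u = 0; last by lra.
apply: (@cos_inj R); [by rewrite in_itv/=; lra|by rewrite in_itv/= lexx ltW|].
by rewrite mulrC mulr_natr addrC cosD2pi cosN cu cos0.
Qed.

Lemma cexp_eq1 z : cexp z = 1 -> exists k : int, z = 0 +i* (2 * pi * k%:~R).
Proof.
case: z => a b; rewrite /cexp; simpc => -[ca sa].
(* Adding the squares of the real and imaginary parts isolates the modulus. *)
have ea : expR a = 1.
  have : expR a ^+ 2 = 1.
    rewrite -[LHS]mulr1 -[X in _ * X](cos2Dsin2 b) mulrDr -!exprMn ca sa.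
    by rewrite expr0n addr0 expr1n.
  by move/eqP; rewrite sqrp_eq1 ?expR_ge0 // => /eqP.
have a0 : a = 0 by rewrite -(expRK a) ea ln1.
by move: ca; rewrite ea mul1r => /cos_eq1[k ->]; exists k; rewrite a0.
Qed.

Lemma cexp_period (k : int) : cexp (0 +i* (2 * pi * k%:~R)) = 1 :> R[i].
Proof.
have -> : 0 +i* (2 * pi * k%:~R) = (0 +i* (2 * pi)) *~ k :> R[i].
  rewrite -[RHS]mulrzr -(rmorph_int (real_complex R)) /=.
  by simpc; congr (_ +i* _); rewrite mulrC.
rewrite cexpMz (_ : cexp _ = 1) ?exp1rz//.
by rewrite /cexp/= expR0 mul1r mulr_natl cos2pi sin2pi.
Qed.

Lemma cexp_real x : cexp x%:C = (expR x)%:C.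
Proof. by rewrite /cexp /= cos0 sin0; simpc. Qed.

Lemma cpowD x (a b : R[i]) : cpow x (a + b) = cpow x a * cpow x b.
Proof. by rewrite /cpow mulrDl cexpD. Qed.

Lemma cpowN x (a : R[i]) : cpow x (- a) = (cpow x a)^-1.
Proof. by rewrite /cpow mulNr cexpN. Qed.

Lemma cpow_neq0 x (a : R[i]) : cpow x a != 0.
Proof. exact: cexp_neq0. Qed.

Lemma cpowx0 x : cpow x (0 : R[i]) = 1.
Proof. by rewrite /cpow mul0r cexp0. Qed.

Lemma cpow1x (a : R[i]) : cpow 1 a = 1.
Proof. by rewrite /cpow ln1 mulr0 cexp0. Qed.

Lemma cpowx1 x : 0 < x -> cpow x (1 : R[i]) = x%:C.
Proof. by move=> x0; rewrite /cpow mul1r cexp_real lnK. Qed.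

Lemma cpowM x y (a : R[i]) : 0 < x -> 0 < y ->
  cpow (x * y) a = cpow x a * cpow y a.
Proof.
by move=> x0 y0; rewrite /cpow lnM ?posrE// rmorphD mulrDr cexpD.
Qed.

Lemma cpowV x (a : R[i]) : 0 < x -> cpow x^-1 a = (cpow x a)^-1.
Proof. by move=> x0; rewrite /cpow lnV ?posrE// rmorphN mulrN cexpN. Qed.

Lemma cpow_sum (I : Type) (r : seq I) x (F : I -> R[i]) :
  cpow x (\sum_(i <- r) F i) = \prod_(i <- r) cpow x (F i).
Proof. by rewrite /cpow mulr_suml cexp_sum. Qed.

Lemma cpow_exprz x (k : int) (a : R[i]) : 0 < x ->
  cpow (x ^ k) a = cpow x a ^ k.
Proof.
have H (n : nat) (y : R) : 0 < y -> cpow (y ^+ n) a = cpow y a ^+ n.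
  move=> y0; elim: n => [|n IH]; first exact: cpow1x.
  by rewrite !exprS cpowM ?exprn_gt0// IH.
move=> x0; case: k => n; first exact: H.
by rewrite -![_ ^ Negz n]/((_ ^+ n.+1)^-1) cpowV ?exprn_gt0 ?H.
Qed.

(** Turns the exceptional families mu_j and 1 + mu_j into the conditions p^a = 1 and p^a = p, the
    form in which Gamma_p degenerates. *)
Lemma mu_periodP p (a : R[i]) : prime p ->
  cpow p%:R a = 1 <-> exists j, a = mu_period R p j.
Proof.
move=> /prime_gt1 p1; have lp : ln p%:R != 0 :> R.
  by rewrite gt_eqF// ln_gt0// ltr1n.
split=> [/cexp_eq1[k ak]|[j ->]]; last first.
  rewrite -(cexp_period j) /cpow /mu_period; simpc; congr (cexp (_ +i* _)).
  by field.
exists k; apply: (@mulIf _ ((ln p%:R)%:C)).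
  by rewrite -(rmorph0 (real_complex R)) (inj_eq (@complexI R)).
rewrite ak /mu_period; simpc; congr (_ +i* _).
by field.
Qed.

End Cexp.

(** * p-adic absolute value and fractional part *)

Section PadicArithmetic.
Variables (p : nat) (p_pr : prime p).
Local Notation Qp := (padic p_pr).
Local Notation P := (p%:R : rat).
Implicit Types (x y z : Qp) (k l : int).

Lemma ratP_gt1 : 1 < P.
Proof. by rewrite ltr1n prime_gt1. Qed.
Let P1 := ratP_gt1.
Let P0 : 0 < P. Proof. exact: lt_trans P1. Qed.

Lemma padic_ratrB (q r : rat) : ratr (q - r) = ratr q - ratr r :> Qp.
Proof. by rewrite -!padic_of_ratE rmorphB. Qed.

Lemma padic_ratr0 : ratr 0 = 0 :> Qp.
Proof. by rewrite -padic_of_ratE rmorph0. Qed.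

Lemma padic_abs1 : padic_abs (1 : Qp) = 1.
Proof. by rewrite -[1 in LHS](ratr_nat Qp 1) padic_abs_ratr ratp_abs1. Qed.

Lemma ratp_abs_int (a : int) : a != 0 -> ratp_abs p a%:~R = P ^- logn p `|a|.
Proof.
move=> a0; have := ratp_abs_frac p a0 (oner_neq0 _).
by rewrite divr1 => ->; rewrite logn1 sub0r -invr_expz.
Qed.

Lemma ratp_abs_int_le1 (a : int) : ratp_abs p a%:~R <= 1.
Proof.
have [->|a0] := eqVneq a 0; first by rewrite ratp_abs0.
by rewrite ratp_abs_int// invf_le1 ?exprn_gt0// exprn_ege1// ltW.
Qed.

Lemma padic_absV x : padic_abs x^-1 = (padic_abs x)^-1.
Proof.
have [->|x0] := eqVneq x 0; first by rewrite invr0 padic_abs0 invr0.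
apply: (@mulfI _ (padic_abs x)); first by rewrite padic_abs_eq0.
by rewrite -padic_absM !mulfV ?padic_abs_eq0// padic_abs1.
Qed.

Lemma padic_abs_gt0 x : (0 < padic_abs x) = (x != 0).
Proof. by rewrite lt_neqAle padic_abs_ge0 andbT eq_sym padic_abs_eq0. Qed.

Lemma padic_absB x y :
  padic_abs (x - y) <= Num.max (padic_abs x) (padic_abs y).
Proof. by rewrite -(padic_absN y) padic_absD. Qed.

Lemma padic_absDl x y : padic_abs x < padic_abs y ->
  padic_abs (x + y) = padic_abs y.
Proof.
move=> xy; apply/eqP; rewrite eq_le; apply/andP; split.
  by have := padic_absD x y; rewrite (max_idPr (ltW xy)).
rewrite leNgt; apply/negP => yx.
have := padic_absB (x + y) x; rewrite addrAC subrr add0r.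
by rewrite leNgt gt_max yx xy.
Qed.

(** A rational closer to x than |x| has the same absolute value, so the value group is that of the
    rationals. *)
Lemma padic_abs_exprz x : x != 0 -> exists k, padic_abs x = P ^ k.
Proof.
rewrite -padic_abs_gt0 => x0; have [q xq] := padic_dense_rat x x0.
have qx : padic_abs (ratr q : Qp) = padic_abs x.
  rewrite -[ratr q](subrK x) padic_absDl//.
  by rewrite -opprB padic_absN.
have {xq}q0 : q != 0.
  by apply: contraTneq x0 => q0; rewrite -qx q0 padic_ratr0 padic_abs0.
by rewrite -qx padic_abs_ratr /ratp_abs (negPf q0); eexists.
Qed.

Lemma padic_abs_pz k : padic_abs (p%:R ^ k : Qp) = P ^ (- k).
Proof.
have H (n : nat) : padic_abs (p%:R ^+ n : Qp) = P ^- n.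
  elim: n => [|n IH]; first by rewrite !expr0 padic_abs1 invr1.
  by rewrite !exprS padic_absM padic_abs_p IH invfM.
case: k => n; rewrite ?NegzE -?exprnP ?H -?invr_expz ?opprK//.
by rewrite padic_absV -!exprnP H invrK.
Qed.

Lemma padic_p_neq0 : (p%:R : Qp) != 0.
Proof. by rewrite -padic_abs_gt0 padic_abs_p invr_gt0. Qed.

(** A rational q within p^(-n) of y is p-integral, so its reduced denominator is invertible modulo
    p^n, and m is the residue of the numerator times that inverse. The bound m < p^n yields
    fractional parts below 1 and, for n = 1, the p cosets that make up a ball. *)
Lemma padic_nat_approx y (n : nat) : padic_abs y <= 1 ->
  exists2 m : nat, (m < p ^ n)%N & padic_abs (y - m%:R) <= P ^- n.
Proof.
have Pn0 : 0 < P ^+ n by rewrite exprn_gt0.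
have PVn0 : 0 < P ^- n by rewrite invr_gt0.
move=> y1; have [q yq] := padic_dense_rat y PVn0.
have q1 : ratp_abs p q <= 1.
  rewrite -(padic_abs_ratr p_pr) -[ratr q](subrK y).
  rewrite (le_trans (padic_absD _ _))// ge_max y1 andbT -opprB padic_absN.
  by rewrite (le_trans (ltW yq))// invf_le1// exprn_ege1// ltW.
have pd : ~~ (p %| `|denq q|)%N.
  apply/negP => pd.
  have q0 : q != 0 by apply: contraTneq pd => ->; rewrite dvdn1 gtn_eqF ?prime_gt1.
  have pn : ~~ (p %| `|numq q|)%N.
    apply/negP => pn; have := coprime_num_den q.
    rewrite /coprime => /eqP h; have : (p %| gcdn `|numq q| `|denq q|)%N.
      by rewrite dvdn_gcd pn pd.
    by rewrite h dvdn1 gtn_eqF ?prime_gt1.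
  move: q1; rewrite leNgt /ratp_abs (negPf q0) (lognE p `|numq q|) (negPf pn).
  rewrite !andbF subr0 -exprnP exprn_egt1 ?ltr1n ?prime_gt1//.
  by rewrite -lt0n logn_gt0 mem_primes p_pr absz_gt0 denq_neq0 pd.
have cop : coprime `|denq q| (p ^ n) by rewrite coprimeXr// coprime_sym prime_coprime.
have pn0 : (0 < p ^ n)%N by rewrite expn_gt0 prime_gt0.
have [[a b] /= ab] : exists ab : int * int, ab.1 * denq q + ab.2 * (p ^ n)%N = 1.
  have := Bezoutz (denq q) (p ^ n)%N; rewrite /gcdz !absz_nat (eqP cop).
  by move=> [a [b ab]]; exists (a, b).
pose m := `|((numq q * a) %% (p ^ n)%N)%Z|%N.
have mE : m%:Z = ((numq q * a) %% (p ^ n)%N)%Z.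
  by rewrite /m gez0_abs// modz_ge0// -lt0n.
exists m.
  by rewrite -ltz_nat mE -[X in _ < X]gez0_abs// ltz_mod// -lt0n.
rewrite -[y](subrK (ratr q)) -addrA (le_trans (padic_absD _ _))// ge_max.
rewrite (ltW yq) /= -(ratr_nat Qp m) -padic_ratrB padic_abs_ratr.
have [c cE] : exists c : int, numq q - m%:Z * denq q = c * (p ^ n)%N.
  exists (numq q * b + ((numq q * a) %/ (p ^ n)%N)%Z * denq q).
  have e1 : numq q = numq q * (a * denq q + b * (p ^ n)%N) by rewrite ab mulr1.
  rewrite mE; have := divz_eq (numq q * a) (p ^ n)%N.
  set r := ((numq q * a) %% _)%Z; set t := ((numq q * a) %/ _)%Z => h.
  rewrite {1}e1 mulrDr mulrA h; ring.
have d0 : (denq q)%:~R != 0 :> rat by rewrite intr_eq0 denq_neq0.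
have -> : q - m%:R = c%:~R * (P ^+ n) / (denq q)%:~R.
  apply: (mulIf d0); rewrite divfK// mulrBl.
  have -> : q * (denq q)%:~R = (numq q)%:~R by rewrite -{1}(divq_num_den q) divfK.
  rewrite -natrX -[(p ^ n)%N%:R]/((p ^ n)%N%:~R) -intrM -cE intrB intrM.
  by [].
have -> : ratp_abs p (c%:~R * P ^+ n / (denq q)%:~R) = ratp_abs p c%:~R * P ^- n.
  have dabs : ratp_abs p (denq q)%:~R = 1.
    by rewrite ratp_abs_int ?denq_neq0// lognE (negPf pd) !andbF expr0 invr1.
  rewrite ratp_absM// ratp_absM// ratp_absV// dabs invr1 mulr1 -natrX.
  rewrite -[(p ^ n)%N%:R]/((p ^ n)%N%:~R) (@ratp_abs_int (p ^ n)%N) ?eqz_nat -?lt0n//.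
  by rewrite absz_nat pfactorK// -[((p ^ n)%N : int)%:~R]/((p ^ n)%N%:R) natrX.
by rewrite ger_pMl ?invr_gt0// ratp_abs_int_le1.
Qed.

(** Numerators are signed here, unlike in [padic_frac], so that Z[1/p] is closed under
    differences. *)
Definition is_pfrac (r : rat) := exists (m : int) (k : nat), r = m%:~R / P ^+ k.

Lemma is_pfracB r s : is_pfrac r -> is_pfrac s -> is_pfrac (r - s).
Proof.
move=> [m [k ->]] [n [l ->]]; exists (m * (p ^ l)%N - n * (p ^ k)%N), (k + l)%N.
rewrite intrB !intrM -![((p ^ _)%N : int)%:~R]/((p ^ _)%N%:R) !natrX exprD.
by field; rewrite !expf_eq0 gt_eqF ?andbF.
Qed.

(** Z[1/p] meets Z_p in Z, because |m / p^k| <= 1 forces p^k to divide m. Hence two candidates for a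
    fractional part differ by an integer. *)
Lemma pfrac_int r : is_pfrac r -> ratp_abs p r <= 1 -> exists m : int, r = m%:~R.
Proof.
move=> [m [k ->]]; have [->|m0] := eqVneq m 0; first by exists 0; rewrite mul0r.
have pk0 : (p ^ k)%N%:Z != 0 by rewrite eqz_nat -lt0n expn_gt0 prime_gt0.
rewrite -natrX -[(p ^ k)%N%:R]/((p ^ k)%N%:~R) ratp_abs_frac//.
rewrite absz_nat pfactorK// -[leRHS](expr0z P) ler_eXz2l// subr_le0 lez_nat => km.
have /dvdnP[c cE] : (p ^ k %| `|m|)%N by rewrite pfactor_dvdn ?absz_gt0.
exists (sgz m * c%:Z).
rewrite {1}[m]intEsg cE PoszM mulrA [in LHS]intrM mulfK//.
by rewrite intr_eq0.
Qed.

Lemma padic_fracP x : [/\ 0 <= padic_frac x < 1, is_pfrac (padic_frac x)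
  & padic_abs (x - ratr (padic_frac x)) <= 1].
Proof.
suff : [set r : rat | [/\ 0 <= r < 1,
    exists m k : nat, r = m%:R / P ^+ k & padic_abs (x - ratr r) <= 1]]
    (padic_frac x).
  by move=> [? [m [k mk]] ?]; split=> //; exists m%:Z, k.
apply: xgetPex.
have [k xk] : exists k : nat, padic_abs x <= P ^+ k.
  have [->|/padic_abs_exprz[l ->]] := eqVneq x 0.
    by exists 0%N; rewrite padic_abs0.
  by exists `|l|%N; rewrite exprnP ler_eXz2l// lez_abs.
have Pk0 : 0 < P ^+ k by rewrite exprn_gt0.
(* p^k x is a p-adic integer; its residue modulo p^k, divided by p^k, is the fractional part. *)
have [|m mk ym] := @padic_nat_approx (x * p%:R ^ k%:Z) k.
  by rewrite padic_absM padic_abs_pz -invr_expz -exprnP ler_pdivrMr ?mul1r.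
exists (m%:R / P ^+ k); split; last 1 first.
- have -> : ratr (m%:R / P ^+ k) = m%:R / p%:R ^+ k :> Qp.
    rewrite -padic_of_ratE fmorph_div rmorphXn !rmorph_nat//.
  have -> : x - m%:R / p%:R ^+ k = (x * p%:R ^ k%:Z - m%:R) * p%:R ^ (- k%:Z).
    rewrite -invr_expz -exprnP mulrBl mulfK//.
    by rewrite expf_neq0// padic_p_neq0.
  by rewrite padic_absM padic_abs_pz opprK -exprnP -ler_pdivlMr ?mul1r.
- by rewrite divr_ge0 ?ler0n ?(ltW Pk0)// ltr_pdivrMr// mul1r -natrX ltr_nat.
- by exists m, k.
Qed.

Lemma padic_frac_unique x (r : rat) : 0 <= r < 1 -> is_pfrac r ->
  padic_abs (x - ratr r) <= 1 -> padic_frac x = r.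
Proof.
move=> /andP[r0 r1] rp xr; have [/andP[s0 s1] sp xs] := padic_fracP x.
set s := padic_frac x in s0 s1 sp xs *.
have [|m srm] := pfrac_int (is_pfracB sp rp).
  rewrite -(padic_abs_ratr p_pr) padic_ratrB.
  have -> : ratr s - ratr r = (x - ratr r) - (x - ratr s) :> Qp by ring.
  by rewrite (le_trans (padic_absB _ _))// ge_max xr.
have : -1 < m%:~R :> rat by rewrite -srm; lra.
have : m%:~R < 1 :> rat by rewrite -srm; lra.
rewrite ltrz1 -(ltr_int rat) => m1; rewrite -mulrN1z ltr_int => m2.
have m0 : m = 0 by move: m1; rewrite ltr_int; lia.
by move: srm; rewrite m0 => /eqP; rewrite subr_eq0 => /eqP.
Qed.

Lemma padic_frac_int x : padic_abs x <= 1 -> padic_frac x = 0.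
Proof.
move=> x1; apply: padic_frac_unique; rewrite ?lexx ?ltr01 ?padic_ratr0 ?subr0//.
by exists 0, 0%N; rewrite mul0r.
Qed.

Lemma padic_absB_le1 x y : padic_abs x <= 1 -> padic_abs y <= 1 ->
  padic_abs (x - y) <= 1.
Proof. by move=> x1 y1; rewrite (le_trans (padic_absB _ _))// ge_max x1. Qed.

(** The discrepancy lies in Z[1/p] and in Z_p, hence in Z; the exponential does not see it, which
    makes [chi] additive. *)
Lemma padic_fracD x y : exists m : int,
  padic_frac (x + y) = padic_frac x + padic_frac y - m%:~R.
Proof.
have [_ xp xs] := padic_fracP x; have [_ yp ys] := padic_fracP y.
have [_ zp zs] := padic_fracP (x + y).
have NN (r s : rat) : r + s = r - (0 - s) by ring.
have z0 : is_pfrac 0 by exists 0, 0%N; rewrite mul0r.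
have [||m mE] := @pfrac_int (padic_frac x + padic_frac y - padic_frac (x + y)).
- by apply: is_pfracB => //; rewrite NN; apply: is_pfracB => //; apply: is_pfracB.
- rewrite -(padic_abs_ratr p_pr) (NN (padic_frac x)) !padic_ratrB padic_ratr0.
  have -> (a b c : Qp) : a - (0 - b) - c = (x + y - c) - (x - a) - (y - b).
    by ring.
  by apply: padic_absB_le1 ys; exact: padic_absB_le1 zs xs.
- by exists m; rewrite -mE; ring.
Qed.

End PadicArithmetic.

(** * The additive character, locally constant functions and Haar measure of balls *)

Section AdditiveCharacter.
Variables (R : realType) (p : nat) (p_pr : prime p).
Local Notation Qp := (padic p_pr).
Local Notation P := (p%:R : rat).
Local Open Scope complex_scope.
Implicit Types (x y z b : Qp) (k l : int).

Definition chi x : R[i] := cexp (0 +i* (2 * pi * ratr (padic_frac x))).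

Lemma chiD x y : chi (x + y) = chi x * chi y.
Proof.
have [m E] := padic_fracD x y.
rewrite /chi E -cexpD -[LHS]mulr1 -(cexp_period R m) -cexpD; congr cexp.
simpc; congr (_ +i* _).
by rewrite rmorphB rmorphD /= ratr_int; ring.
Qed.

Lemma chi_int x : padic_abs x <= 1 -> chi x = 1.
Proof.
by move=> x1; rewrite /chi padic_frac_int// rmorph0 mulr0 -[RHS]cexp0.
Qed.

Lemma chi0 : chi 0 = 1. Proof. by rewrite chi_int// padic_abs0 ler01. Qed.

(** All cancellation in integrals of characters comes from this single nontrivial value just outside
    Z_p. *)
Lemma chi_pV : chi p%:R^-1 != 1.
Proof.
have p1 := ratP_gt1 p_pr; have p0 : 0 < P by exact: lt_trans p1.
have -> : chi p%:R^-1 = cexp (0 +i* (2 * pi * p%:R^-1)).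
  rewrite /chi (@padic_frac_unique _ _ _ P^-1).
  - by rewrite fmorphV /= ratr_nat.
  - by rewrite invr_ge0 (ltW p0) invf_lt1.
  - by exists 1, 1%N; rewrite expr1 mul1r.
  - suff -> : ratr P^-1 = p%:R^-1 :> Qp by rewrite subrr padic_abs0.
    by rewrite -padic_of_ratE fmorphV rmorph_nat.
apply/eqP => /cexp_eq1[k [kp]].
have {}kp : (p%:R : R)^-1 = k%:~R.
  by apply: (mulfI _ kp); rewrite mulf_neq0 ?pnatr_eq0// gt_eqF// pi_gt0.
have : (0 : R) < k%:~R by rewrite -kp invr_gt0 ltr0n prime_gt0.
have : k%:~R < (1 : R) by rewrite -kp invf_lt1 ?ltr1n ?ltr0n ?prime_gt1 ?prime_gt0.
by rewrite ltr0z ltrz1; lia.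
Qed.

Lemma additive_charE n (xi x : 'rV[Qp]_n) :
  additive_char R xi x = \prod_j chi (xi 0 j * x 0 j).
Proof.
rewrite -cexp_sum /additive_char; congr cexp.
have imD : {morph (fun y : R => 0 +i* y) : a b / a + b} by move=> a b; simpc.
by rewrite mulr_sumr (big_morph _ imD (erefl _)).
Qed.

Lemma chi_le1 x : `|complex.Re (chi x)| <= 1 /\ `|complex.Im (chi x)| <= 1.
Proof. by rewrite /chi /cexp/= expR0; simpc; rewrite cos_max sin_max. Qed.

End AdditiveCharacter.
Arguments chi R {p p_pr} x.

Section LocallyConstant.
Variables (p : nat) (p_pr : prime p).
Local Notation Qp := (padic p_pr).
Local Notation P := (p%:R : rat).
Implicit Types (x y z b : Qp) (k l : int).

(** The target is any type, so that membership of a ball (a boolean) and the absolute value are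
    handled like complex-valued functions. *)
Definition loc_cst {T : Type} (f : Qp -> T) x :=
  exists2 e : rat, 0 < e & forall y, padic_abs (y - x) < e -> f y = f x.

Lemma nbhs_padicP x (A : set Qp) :
  nbhs x A <-> exists2 e : rat, 0 < e & forall y, padic_abs (y - x) < e -> A y.
Proof.
rewrite nbhs_ballP; split=> -[e e0 xA]; exists e => // y xy; apply: xA;
  by move: xy; rewrite ballEmdist/= /mdist/= /padic_dist -opprB padic_absN.
Qed.

Lemma padic_openP (A : set Qp) : open A <->
  forall x, A x -> exists2 e : rat, 0 < e & forall y, padic_abs (y - x) < e -> A y.
Proof.
rewrite openE; split=> AP x Ax; first exact/nbhs_padicP/AP.
exact/nbhs_padicP/AP.
Qed.

Lemma loc_cstT T U (h : T -> U) (f : Qp -> T) x :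
  loc_cst f x -> loc_cst (h \o f) x.
Proof. by move=> [e e0 fe]; exists e => // y /fe /= ->. Qed.

Lemma loc_cst2 T U V (h : T -> U -> V) (f : Qp -> T) (g : Qp -> U) x :
  loc_cst f x -> loc_cst g x -> loc_cst (fun y => h (f y) (g y)) x.
Proof.
move=> [e e0 fe] [d d0 gd]; exists (Num.min e d); first by rewrite lt_min e0.
by move=> y; rewrite lt_min => /andP[/fe -> /gd ->].
Qed.

Lemma loc_cst_abs x : x != 0 -> loc_cst (@padic_abs _ p_pr) x.
Proof.
rewrite -padic_abs_gt0 => x0; exists (padic_abs x) => // y yx.
by rewrite -[y](subrK x) padic_absDl.
Qed.

Lemma loc_cst_affine T (f : Qp -> T) c d x : loc_cst f (c * x + d) ->
  loc_cst (fun y => f (c * y + d)) x.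
Proof.
move=> [e e0 fe]; exists (e / (padic_abs c + 1)).
  by rewrite divr_gt0// ltr_wpDl ?padic_abs_ge0.
move=> y yx; apply: fe; rewrite opprD addrACA subrr addr0 -mulrBr padic_absM.
move: yx; rewrite ltr_pdivlMr; last by rewrite ltr_wpDl ?padic_abs_ge0.
apply: le_lt_trans; rewrite mulrC ler_wpM2l ?padic_abs_ge0// lerDl.
by rewrite ler01.
Qed.

Lemma loc_cst_chi R b x : loc_cst (fun z => chi R (b * z)) x.
Proof.
have {1}-> : (fun z => chi R (b * z)) = (fun z => chi R (b * z + 0)).
  by apply/funext => z; rewrite addr0.
apply: (@loc_cst_affine _ (chi R)); exists 1 => // y y1.
by rewrite -[y in LHS](subrK (b * x + 0)) chiD chi_int ?mul1r ?ltW.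
Qed.

(** By the ultrametric inequality a displacement smaller than r cannot cross the boundary of a ball
    of radius r. *)
Lemma loc_cst_le (r : rat) x y : 0 < r -> loc_cst (fun z => padic_abs (z - y) <= r) x.
Proof.
move=> r0; exists r => // z zx; have [xr|xr] := leP (padic_abs (x - y)) r.
  have -> : z - y = (z - x) + (x - y) by rewrite addrA subrK.
  by rewrite (le_trans (padic_absD _ _))// ge_max (ltW zx).
have -> : z - y = (z - x) + (x - y) by rewrite addrA subrK.
by rewrite padic_absDl ?(lt_trans zx)// leNgt xr.
Qed.

Lemma open_measurable_padic (A : set Qp) : open A -> measurable A.
Proof. by move=> oA; exact: sub_sigma_algebra. Qed.

Lemma measurable_padic1 x : measurable [set x].
Proof.
suff : open (~` [set x]).
  by move/open_measurable_padic/measurableC; rewrite setCK.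
apply/padic_openP => y /= yx; exists (padic_abs (x - y)).
  by rewrite padic_abs_gt0 subr_eq0; apply/eqP => xy; exact: yx.
by move=> z zy zx; move: zy; rewrite zx ltxx.
Qed.

(** The origin is excepted because densities such as ln |z| are not locally constant there; it is
    split off as a measurable singleton. *)
Lemma measurable_loc_cst d (T : measurableType d) (f : Qp -> T) (D : set Qp) :
  measurable D -> (forall x, x != 0 -> loc_cst f x) -> measurable_fun D f.
Proof.
move=> mD lf; apply: (@measurable_funS _ _ _ _ setT) => // _ A mA.
rewrite setTI; have -> : f @^-1` A = (f @^-1` A `\ 0) `|` (f @^-1` A `&` [set 0]).
  by rewrite setUC setUIDK.
apply: measurableU.
  suff : open (f @^-1` A `\ 0) by exact: open_measurable_padic.
  apply/padic_openP => x [/= Ax x0].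
  have {}x0 : x != 0 by apply/eqP.
  have [e e0 fe] := lf x x0.
  exists (Num.min e (padic_abs x)).
    by rewrite lt_min e0 padic_abs_gt0.
  move=> y; rewrite lt_min => /andP[/fe fy yx]; split; first by rewrite /= fy.
  by move=> /= y0; move: yx; rewrite y0 sub0r padic_absN ltxx.
have [f0|f0] := pselect (A (f 0)).
  rewrite (_ : _ `&` _ = [set 0]); first exact: measurable_padic1.
  by apply/seteqP; split=> [x []//|x ->].
rewrite (_ : _ `&` _ = set0); first exact: measurable0.
by apply/seteqP; split=> [x [] /[swap] /= ->//|x //].
Qed.

Lemma measurable_translation y : measurable_fun setT (fun x : Qp => y + x).
Proof.
apply: (@measurability _ _ _ _ _ _ (@open Qp)); first by [].
move=> _ [A oA <-]; rewrite setTI.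
suff : open ((fun x : Qp => y + x) @^-1` A) by exact: open_measurable_padic.
apply/padic_openP => x /= Ax; have /padic_openP/(_ _ Ax)[e e0 eA] := oA.
exists e => // z zx; apply: eA.
by rewrite opprD addrACA subrr add0r.
Qed.

Definition pball k : set Qp := [set x | padic_abs x <= P ^ k].

Lemma measurable_pball k : measurable (pball k).
Proof.
suff : open (pball k) by exact: open_measurable_padic.
apply/padic_openP => x xk; have P0 : 0 < P ^ k by rewrite exprz_gt0// (lt_trans _ (ratP_gt1 p_pr)).
have [e e0 xe] := loc_cst_le x 0 P0.
exists e => // y /xe; rewrite !subr0 => yE.
by rewrite /pball /= yE.
Qed.

End LocallyConstant.

Section HaarBalls.
Variables (R : realType) (p : nat) (p_pr : prime p).
Local Notation Qp := (padic p_pr).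
Local Notation P := (p%:R : rat).
Local Notation B := (@pball p p_pr).
Variable mu : {measure set Qp -> \bar R}.
Hypothesis mu_haar : haar_measure mu.
Implicit Types (x y z b : Qp) (k l : int).

Let p0 : 0 < (p%:R : R). Proof. by rewrite ltr0n prime_gt0. Qed.
Let P0 : 0 < P. Proof. by rewrite ltr0n prime_gt0. Qed.
Let P1 : 1 < P := ratP_gt1 p_pr.

Let ratPz_div k : P ^ k / P ^ (k + 1) = P^-1.
Proof.
have Pk : P ^ k != 0 by rewrite expfz_neq0// gt_eqF.
by rewrite expfzDr ?gt_eqF// expr1z invfM mulrA mulfV// mul1r.
Qed.

Lemma haar_pball0 : mu (B 0) = 1%E.
Proof.
rewrite -(proj2 mu_haar); congr (mu _); apply/seteqP; split=> x;
  by rewrite /pball /= /padic_norm -(ler_rat R) expr0z rmorph1.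
Qed.

(** The translates are indexed by the leading digit of y, that is, the class of y p^(k+1) in Z_p / p
    Z_p. *)
Lemma pball_succ k : B (k + 1) =
  \big[setU/set0]_(i < p) [set i%:R * p%:R ^ (- (k + 1)) + x | x in B k].
Proof.
have Pk0 : 0 < P ^ k by rewrite exprz_gt0.
apply/seteqP; split=> [y /= yk|y].
  have [|m mp ym] := @padic_nat_approx _ _ (y * p%:R ^ (k + 1)) 1.
    by rewrite padic_absM padic_abs_pz -invr_expz ler_pdivrMr ?exprz_gt0// mul1r.
  rewrite expn1 in mp; rewrite -(bigcup_mkord p (fun i =>
    [set i%:R * p%:R ^ (- (k + 1)) + x | x in B k])).
  exists m => //=; exists (y - m%:R * p%:R ^ (- (k + 1))); last by rewrite addrC subrK.
  have -> : y - m%:R * p%:R ^ (- (k + 1)) =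
      (y * p%:R ^ (k + 1) - m%:R) * p%:R ^ (- (k + 1)).
    by rewrite -invr_expz mulrBl mulfK// expfz_neq0// padic_p_neq0.
  rewrite /pball /= padic_absM padic_abs_pz opprK -ler_pdivlMr ?exprz_gt0//.
  by rewrite ratPz_div.
rewrite -(bigcup_mkord p (fun i =>
    [set i%:R * p%:R ^ (- (k + 1)) + x | x in B k])).
move=> [i /= ip [x xk <-]].
rewrite /pball /= (le_trans (padic_absD _ _))// ge_max; apply/andP; split.
  rewrite padic_absM padic_abs_pz opprK ger_pMl ?exprz_gt0//.
  by rewrite -(ratr_nat Qp) padic_abs_ratr; exact: (ratp_abs_int_le1 p_pr i).
by rewrite (le_trans xk)// ler_eXz2l// lerDl.
Qed.

Lemma haar_pball_succ k : mu (B (k + 1)) = (p%:R%:E * mu (B k))%E.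
Proof.
have Pk0 : 0 < P ^ k by rewrite exprz_gt0.
have mB (i : 'I_p) : measurable
    [set i%:R * p%:R ^ (- (k + 1)) + x | x in B k].
  set c := i%:R * _.
  rewrite (_ : image _ _ = (fun x => - c + x) @^-1` B k).
    rewrite -[X in measurable X]setTI; apply: measurable_translation => //.
    exact: measurable_pball.
  apply/seteqP; split=> [_ [x xk <-]|x xk]; first by rewrite /= addKr.
  by exists (- c + x) => //; rewrite addNKr.
rewrite pball_succ measure_bigsetU_ord//.
  rewrite (eq_bigr (fun=> mu (B k))).
    by rewrite sumr_const card_ord mule_natl.
  by move=> i _; apply: (proj1 mu_haar); exact: measurable_pball.
(* Two translates that meet would give |j - i| p^(k+1) <= p^k, but the difference of distinct digits
   is a p-adic unit. *)
apply/trivIsetP => /= i j _ _ ij; set q := (p%:R : Qp) ^ _; apply/seteqP; split=> // z [[x xk <-] [y yk]].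
move=> /eqP; rewrite -subr_eq0 opprD addrACA -mulrBl => /eqP xy.
have : padic_abs ((j%:R - i%:R) * q) <= P ^ k.
  rewrite -[X in padic_abs X](addrK (y - x)) xy sub0r padic_absN.
  by rewrite (le_trans (padic_absB _ _))// ge_max; apply/andP.
rewrite padic_absM /q padic_abs_pz opprK -ler_pdivlMr ?exprz_gt0//.
rewrite ratPz_div.
rewrite leNgt => /negP; apply.
suff -> : padic_abs (j%:R - i%:R : Qp) = 1 by rewrite invf_lt1.
have -> : j%:R - i%:R = ratr ((j%:Z - i%:Z)%:~R) :> Qp.
  by rewrite intrB padic_ratrB !ratr_nat.
have ji0 : j%:Z - i%:Z != 0.
  by rewrite subr_eq0 eqz_nat; apply: contra ij => /eqP/val_inj ->.
rewrite padic_abs_ratr ratp_abs_int// lognE.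
suff /negPf -> : ~~ (p %| `|j%:Z - i%:Z|)%N by rewrite !andbF invr1.
rewrite gtnNdvd ?absz_gt0//; have := ltn_ord i; have := ltn_ord j; lia.
Qed.

Lemma haar_pball k : mu (B k) = (p%:R ^ k)%:E.
Proof.
elim/int_ind: k => [|n IH|n IH].
- by rewrite haar_pball0 expr0z.
- by rewrite -addn1 PoszD haar_pball_succ IH -EFinM -exprSz addrC.
- have := haar_pball_succ (- n.+1%:Z).
  have -> : - n.+1%:Z + 1 = - n%:Z by rewrite -addn1 PoszD opprD subrK.
  rewrite IH => h; have := congr1 (fun u => ((p%:R^-1 : R)%:E * u)%E) h.
  rewrite muleA -!EFinM mulVf ?gt_eqF// mul1e => <-; congr (_%:E).
  by rewrite -!invr_expz -!exprnP exprS invfM.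
Qed.

Lemma haar0 : mu [set 0] = 0%E.
Proof.
apply/eqP; rewrite eq_le measure_ge0 andbT; apply/lee_addgt0Pr => e e0.
(* Since n > 1/e and n < p^n, the ball of measure p^(-n) is small enough. *)
rewrite add0e; pose n := (Num.truncn e^-1).+1.
apply: (@le_trans _ _ (mu (B (- n%:Z)))).
  apply: le_measure; rewrite ?inE; [exact: measurable_padic1|exact: measurable_pball|].
  by move=> x ->; rewrite /pball /= padic_abs0 exprz_ge0// ltW.
rewrite haar_pball lee_fin -invr_expz -exprnP invf_ple ?posrE ?exprn_gt0//.
have := truncnS_gt e^-1; rewrite -/n => /ltW/le_trans; apply.
by rewrite -natrX ler_nat ltnW// ltn_expl// prime_gt1.
Qed.

End HaarBalls.

(** * Integration of one-variable test functions *)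

Section ComplexIntegral.
Variables (R : realType) (p : nat) (p_pr : prime p).
Local Notation Qp := (padic p_pr).
Local Notation C := (R[i]).
Variable mu : {measure set Qp -> \bar R}.
Local Open Scope complex_scope.
Implicit Types (f g : Qp -> C) (D : set Qp).

Definition cintegrable D f :=
  mu.-integrable D (EFin \o (fun z => complex.Re (f z))) /\
  mu.-integrable D (EFin \o (fun z => complex.Im (f z))).

Lemma cintegrableZ D (c : C) f : measurable D -> cintegrable D f ->
  cintegrable D (fun z => c * f z).
Proof.
move=> mD [ref imf]; case: c => a b; split.
  apply: (eq_integrable mD (fun z => (a%:E * (complex.Re (f z))%:E +
    (- b)%:E * (complex.Im (f z))%:E)%E)).
    by move=> z _ /=; case: (f z) => u v /=; rewrite -!EFinM -EFinD mulNr.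
  by apply: integrableD => //; exact: integrableZl.
apply: (eq_integrable mD (fun z => (a%:E * (complex.Im (f z))%:E +
    b%:E * (complex.Re (f z))%:E)%E)).
  by move=> z _ /=; case: (f z) => u v.
by apply: integrableD => //; exact: integrableZl.
Qed.

Lemma eq_cintegral D f g : (forall z, D z -> f z = g z) ->
  cintegral mu D f = cintegral mu D g.
Proof.
by move=> fg; congr (_ +i* _); apply: eq_Rintegral => z; rewrite inE => /fg ->.
Qed.

Lemma cintegralD D f g : measurable D -> cintegrable D f -> cintegrable D g ->
  cintegral mu D (fun z => f z + g z) = cintegral mu D f + cintegral mu D g.
Proof.
move=> mD [ref imf] [reg img]; rewrite /cintegral; simpc.
rewrite -!RintegralD//; congr (_ +i* _); apply: eq_Rintegral => z _;
  by case: (f z) (g z) => u v [].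
Qed.

Lemma cintegralZ D (c : C) f : measurable D -> cintegrable D f ->
  cintegral mu D (fun z => c * f z) = c * cintegral mu D f.
Proof.
move=> mD [ref imf]; case: c => a b; rewrite /cintegral; simpc.
have iZ (r : R) (h : Qp -> R) : mu.-integrable D (EFin \o h) ->
    mu.-integrable D (EFin \o (fun z => r * h z)).
  exact: integrableZl.
rewrite -!RintegralZl// -RintegralB ?iZ// -RintegralD ?iZ//.
by congr (_ +i* _); apply: eq_Rintegral => z _; case: (f z).
Qed.

Lemma cintegral_setC D f : measurable D -> cintegrable setT f ->
  cintegral mu D f + cintegral mu (~` D) f = cintegral mu setT f.
Proof.
move=> mD [ref imf]; rewrite /cintegral; simpc; rewrite -(setUv D).
have dD : [disjoint D & ~` D] by apply/disj_setPS; rewrite setICr.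
by rewrite !Rintegral_setU ?setUv//; exact: measurableC.
Qed.

Lemma cintegral_mkcond D f :
  cintegral mu D f = cintegral mu setT (fun z => if z \in D then f z else 0).
Proof.
rewrite /cintegral; congr (_ +i* _); rewrite Rintegral_mkcond;
  by apply: eq_Rintegral => z _; rewrite patchE; case: ifP.
Qed.

End ComplexIntegral.

Section TestFunctions.
Variables (R : realType) (p : nat) (p_pr : prime p).
Local Notation Qp := (padic p_pr).
Local Notation C := (R[i]).
Local Notation P := (p%:R : rat).
Local Notation B := (@pball p p_pr).
Local Open Scope complex_scope.
Implicit Types (f g : Qp -> C) (k l : int) (x b z : Qp).

(* Boundedness is required explicitly, which spares the proof that the balls
   of Q_p are compact. *)
Definition test1 f :=
  [/\ forall x, loc_cst f x, exists k, forall z, ~ B k z -> f z = 0 &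
    exists M : R, forall z, `|complex.Re (f z)| <= M /\ `|complex.Im (f z)| <= M].

Lemma pball_le k l : k <= l -> B k `<=` B l.
Proof.
by move=> kl x xk; rewrite /pball /= (le_trans xk)// ler_eXz2l// (ratP_gt1 p_pr).
Qed.

Lemma in_pball k z : (z \in B k) = (padic_abs z <= P ^ k).
Proof. by apply/idP/idP; rewrite inE. Qed.

Lemma test1D f g : test1 f -> test1 g -> test1 (fun z => f z + g z).
Proof.
move=> [lf [k fk] [M fM]] [lg [l gl] [N gN]]; split.
- by move=> x; apply: (loc_cst2 +%R).
- exists (Num.max k l) => z zkl; rewrite fk ?gl ?addr0// => h; apply: zkl;
    by apply: pball_le h; rewrite le_max lexx ?orbT.
- exists (M + N) => z; have [f1 f2] := fM z; have [g1 g2] := gN z.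
  by case: (f z) (g z) f1 f2 g1 g2 => a b [c d] /= *;
    split; rewrite (le_trans (ler_normD _ _))// lerD.
Qed.

Lemma test1M f g : (forall x, loc_cst g x) ->
  (exists M : R, forall z, `|complex.Re (g z)| <= M /\ `|complex.Im (g z)| <= M) ->
  test1 f -> test1 (fun z => g z * f z).
Proof.
move=> lg [N gN] [lf [k fk] [M fM]]; split.
- by move=> x; apply: (loc_cst2 *%R).
- by exists k => z /fk ->; rewrite mulr0.
- exists (N * M + N * M) => z; have [f1 f2] := fM z; have [g1 g2] := gN z.
  case: (f z) (g z) f1 f2 g1 g2 => a b [c d] /= *.
  split; first rewrite -[_ - _]/(c * a + - (d * b)).
    by rewrite (le_trans (ler_normD _ _))// normrN !normrM lerD// ler_pM.
  by rewrite (le_trans (ler_normD _ _))// !normrM lerD// ler_pM.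
Qed.

Lemma test1Z (c : C) f : test1 f -> test1 (fun z => c * f z).
Proof.
apply: (test1M (g := fun=> c)).
  by move=> x; exists 1.
exists (Num.max `|complex.Re c| `|complex.Im c|) => _.
by rewrite !le_max !lexx orbT.
Qed.

Lemma test1_0 : test1 (fun=> 0).
Proof.
split; first by move=> x; exists 1.
  by exists 0.
by exists 0 => z; rewrite normr0.
Qed.

Lemma test1_sum (I : Type) (r : seq I) (c : I -> C) (u : I -> Qp -> C) :
  (forall i, test1 (u i)) -> test1 (fun z => \sum_(i <- r) c i * u i z).
Proof.
move=> tu; elim: r => [|i r IH].
  by under eq_fun do rewrite big_nil; exact: test1_0.
under eq_fun do rewrite big_cons.
by apply: test1D IH; exact: test1Z.
Qed.

(** Restricted to test functions because integrals are additive only where they converge. *)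
Definition linear_test1 (T : (Qp -> C) -> C) :=
  forall c f g, test1 f -> test1 g ->
    T (fun z => c * f z + g z) = c * T f + T g.

Lemma linear_test1_sum T (I : Type) (r : seq I) (c : I -> C) (u : I -> Qp -> C) :
  linear_test1 T -> (forall i, test1 (u i)) ->
  T (fun z => \sum_(i <- r) c i * u i z) = \sum_(i <- r) c i * T (u i).
Proof.
move=> Tl tu; elim: r => [|i r IH].
  under eq_fun do rewrite big_nil; rewrite big_nil.
  have := Tl 1 _ _ test1_0 test1_0.
  under eq_fun do rewrite mulr0 addr0.
  by rewrite mul1r => /eqP; rewrite -subr_eq0 opprD addrA subrr sub0r oppr_eq0 => /eqP.
under eq_fun do rewrite big_cons; rewrite big_cons.
by rewrite Tl ?IH//; exact: test1_sum.
Qed.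

(** A character cut off to a ball. Frequency b = 0 gives indicators of balls; their Fourier
    transforms, and the reflected translates of those, are again multiples of waves, so every
    computation stays in this family. *)
Definition wave x k b z : C := if padic_abs (z - x) <= P ^ k then chi R (b * z) else 0.

Lemma test1_wave x k b : test1 (wave x k b).
Proof.
have Pk : 0 < P ^ k by rewrite exprz_gt0// (lt_trans _ (ratP_gt1 p_pr)).
split.
- move=> y; rewrite /wave.
  apply: (loc_cst2 (fun (t : bool) (c : C) => if t then c else 0)).
    exact: loc_cst_le.
  exact: loc_cst_chi.
- have [l xl] : exists l, padic_abs x <= P ^ l.
    have [->|/padic_abs_exprz[l ->]] := eqVneq x 0; last by exists l.
    by exists 0; rewrite padic_abs0.
  exists (Num.max k l) => z zB; rewrite /wave; case: ifP => // zx.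
  case: zB; rewrite /pball /= -(subrK x z) (le_trans (padic_absD _ _))// ge_max.
  rewrite (le_trans zx) ?(le_trans xl)// ler_eXz2l ?(ratP_gt1 p_pr)//;
    by rewrite le_max lexx ?orbT.
- exists 1 => z; rewrite /wave; case: ifP => _; first exact: chi_le1.
  by rewrite normr0.
Qed.

End TestFunctions.

(** * Translation invariance and orthogonality of characters on balls *)

Section TestIntegrals.
Variables (R : realType) (p : nat) (p_pr : prime p).
Local Notation Qp := (padic p_pr).
Local Notation C := (R[i]).
Local Notation P := (p%:R : rat).
Local Notation B := (@pball p p_pr).
Variable mu : {measure set Qp -> \bar R}.
Hypothesis mu_haar : haar_measure mu.
Local Open Scope complex_scope.
Implicit Types (f g : Qp -> C) (k l : int) (x b z : Qp).

Lemma integrable_bounded_pball (f : Qp -> R) k (M : R) :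
  (forall x, x != 0 -> loc_cst f x) -> (forall z, ~ B k z -> f z = 0) ->
  (forall z, `|f z| <= M) -> mu.-integrable setT (EFin \o f).
Proof.
move=> lf fk fM; have mB := measurable_pball (p_pr := p_pr) k.
suff : mu.-integrable (B k) (EFin \o f).
  move/(integrable_mkcond _ mB); congr (integrable _ _ _).
  apply/funext => z; rewrite patchE; case: ifPn => // /negP zB.
  by rewrite /= fk// => h; apply: zB; rewrite inE.
apply: measurable_bounded_integrable => //.
- by rewrite haar_pball// ltry.
- exact: measurable_loc_cst.
- exists M; split; first exact: num_real.
  by move=> N MN z _ /=; rewrite (le_trans (fM z))// ltW.
Qed.

Lemma Rintegral0 (D : set Qp) : \int[mu]_(x in D) 0 = 0 :> R.
Proof. by rewrite /Rintegral integral0. Qed.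

Lemma test1_cintegrable f : test1 f -> cintegrable mu setT f.
Proof.
move=> [lf [k fk] [M fM]]; split; apply: (@integrable_bounded_pball _ k M).
- by move=> x _; exact: (loc_cstT (@complex.Re R)).
- by move=> z /fk ->.
- by move=> z; case: (fM z).
- by move=> x _; exact: (loc_cstT (@complex.Im R)).
- by move=> z /fk ->.
- by move=> z; case: (fM z).
Qed.

Lemma linear_cintegral : linear_test1 (cintegral mu setT).
Proof.
move=> c f g tf tg; rewrite cintegralD ?cintegralZ//;
  try exact: test1_cintegrable.
by apply: cintegrableZ => //; exact: test1_cintegrable.
Qed.

(** Invariance on sets says that mu is its own pushforward under z |-> y + z; the integrals follow
    by change of variables. *)
Lemma cintegral_translation f y : test1 f ->
  cintegral mu setT (fun z => f (y + z)) = cintegral mu setT f.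
Proof.
move=> tf; have [ref imf] := test1_cintegrable tf.
have mt := measurable_translation (p_pr := p_pr) y.
have H (g : Qp -> R) : (forall x, loc_cst g x) ->
    mu.-integrable setT (EFin \o g) -> mu.-integrable setT (EFin \o (fun z => g (y + z))) ->
    \int[mu]_x g (y + x) = \int[mu]_x g x.
  move=> lg ig igy; rewrite /Rintegral; congr fine.
  transitivity (\int[pushforward mu (fun z => (y + z)%R)]_x (g x)%:E)%E.
    rewrite (integral_pushforward (f := EFin \o g) mt)//.
    apply/measurable_EFinP; exact: measurable_loc_cst.
  apply: eq_measure_integral => A mA _; rewrite /pushforward.
  rewrite -[RHS](proj1 mu_haar (- y))//; congr (mu _).
  apply/seteqP; split=> [x /= yx|_ /= [x Ax <-]]; first by exists (y + x); rewrite ?addKr.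
  by rewrite addNKr.
have tfy : test1 (fun z => f (y + z)).
  have [lf [k fk] [M fM]] := tf; split; last by exists M.
  - move=> x; have {1}-> : (fun z => f (y + z)) = (fun z => f (1 * z + y)).
      by apply/funext => z; rewrite mul1r addrC.
    exact: loc_cst_affine.
  - have [l yl] : exists l, padic_abs y <= P ^ l.
      have [->|/padic_abs_exprz[l ->]] := eqVneq y 0; last by exists l.
      by exists 0; rewrite padic_abs0.
    exists (Num.max k l) => z zB; apply: fk => yz; apply: zB.
    rewrite /pball /= -[z](addKr y) addrC (le_trans (padic_absB _ _))// ge_max.
    rewrite (le_trans yz) ?(le_trans yl)// ler_eXz2l ?(ratP_gt1 p_pr)//;
    by rewrite le_max lexx ?orbT.
have [rey imy] := test1_cintegrable tfy.
have [lf _ _] := tf.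
rewrite /cintegral; congr (_ +i* _).
  by rewrite (H (fun z => complex.Re (f z)))// => x; exact: (loc_cstT (@complex.Re R)).
by rewrite (H (fun z => complex.Im (f z)))// => x; exact: (loc_cstT (@complex.Im R)).
Qed.

Lemma cintegral_wave0 k b : cintegral mu setT (wave R 0 k b) =
  if padic_abs b * P ^ k <= 1 then (p%:R ^ k)%:C else 0.
Proof.
have P1 := ratP_gt1 p_pr; have P0 : 0 < P by exact: lt_trans P1.
case: ifPn => [bk|].
  have -> : wave R 0 k b = (fun z => if z \in B k then 1 else 0).
    apply/funext => z; rewrite /wave subr0 in_pball; case: ifPn => // zk.
    by apply: chi_int; rewrite padic_absM (le_trans _ bk)// ler_wpM2l ?padic_abs_ge0.
  rewrite -(cintegral_mkcond _ _ (fun=> 1)) /cintegral.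
  have mB := measurable_pball (p_pr := p_pr) k.
  rewrite /= !Rintegral_cst// mul0r mul1r haar_pball//.
rewrite -ltNge => bk; have b0 : b != 0.
  by apply: contraTneq bk => ->; rewrite padic_abs0 mul0r ltr10.
have [j bj] := padic_abs_exprz b0.
(* As |b| p^k is at least p, the point c lies in the ball, and chi(b c) = chi(1/p) is not 1.
   Translation by c thus multiplies the integral by a number other than 1 without changing it. *)
pose c : Qp := p%:R^-1 / b.
have ck : padic_abs c <= P ^ k.
  move: bk; rewrite /c padic_absM !padic_absV padic_abs_p invrK bj.
  rewrite -expfzDr ?gt_eqF// -[X in X < _](expr0z P) ltr_eXz2l// => jk.
  rewrite -[X in X * _](expr1z P) -[P ^ j]invrK invr_expz invrK -expfzDr ?gt_eqF//.
  rewrite ler_eXz2l//; lia.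
have bc : b * c = p%:R^-1 by rewrite /c mulrC divfK.
have E : (fun z => wave R 0 k b (c + z)) =
    (fun z => chi R (p%:R^-1 : Qp) * wave R 0 k b z + 0).
  apply/funext => z; rewrite addr0 /wave !subr0.
  have -> : (padic_abs (c + z) <= P ^ k) = (padic_abs z <= P ^ k).
    apply/idP/idP => zk; last by rewrite (le_trans (padic_absD _ _))// ge_max ck.
    by rewrite -[z](addKr c) addrC (le_trans (padic_absB _ _))// ge_max zk.
  by case: ifP => _; rewrite ?mulr0// mulrDr bc chiD.
apply/eqP; have := cintegral_translation c (test1_wave R 0 k b).
rewrite E linear_cintegral; [|exact: test1_wave|exact: test1_0].
have -> : cintegral mu setT (fun=> 0) = 0.
  by rewrite /cintegral /= !Rintegral0.
rewrite addr0 => /eqP; rewrite -[X in _ == X]mul1r -subr_eq0 -mulrBl mulf_eq0.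
by rewrite subr_eq0 (negPf (chi_pV _ _)).
Qed.

Lemma cintegral_wave x k b : cintegral mu setT (wave R x k b) =
  chi R (b * x) * (if padic_abs b * P ^ k <= 1 then (p%:R ^ k)%:C else 0).
Proof.
rewrite -cintegral_wave0 -(cintegral_translation x); last exact: test1_wave.
rewrite -[RHS]addr0.
have <- : cintegral mu setT (fun=> 0) = 0 by rewrite /cintegral /= !Rintegral0.
rewrite -linear_cintegral; [|exact: test1_wave|exact: test1_0].
apply: eq_cintegral => z _; rewrite /wave addr0 subr0 addrAC subrr add0r.
by case: ifP => _; rewrite ?mulr0// mulrDr chiD.
Qed.

End TestIntegrals.

(** * Riesz kernels *)

Section RadialFunctional.
Variables (R : realType) (p : nat) (p_pr : prime p).
Local Notation Qp := (padic p_pr).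
Local Notation C := (R[i]).
Local Notation P := (p%:R : rat).
Local Notation B := (@pball p p_pr).
Variable mu : {measure set Qp -> \bar R}.
Hypothesis mu_haar : haar_measure mu.
Local Open Scope complex_scope.
Implicit Types (f g : Qp -> C) (k l m N : int) (x b z : Qp).

Let P1 : 1 < P := ratP_gt1 p_pr.
Let P0 : 0 < P. Proof. exact: lt_trans P1. Qed.

Lemma ratP_arch (e : rat) : 0 < e -> exists n : nat, P ^- n < e.
Proof.
move=> e0; exists (Num.truncn e^-1).+1; set n := _.+1.
rewrite invf_plt ?posrE ?exprn_gt0//.
have := truncnS_gt e^-1; rewrite -/n => /lt_le_trans; apply.
by rewrite -natrX ler_nat ltnW// ltn_expl// prime_gt1.
Qed.

Lemma bounded_int (h : int -> C) (n : nat) : exists M : R, forall j : int,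
  `|j| <= n%:Z -> `|complex.Re (h j)| <= M /\ `|complex.Im (h j)| <= M.
Proof.
elim: n => [|n [M IH]].
  exists (Num.max `|complex.Re (h 0)| `|complex.Im (h 0)|) => j.
  by rewrite normr_le0 => /eqP ->; rewrite !le_max !lexx orbT.
pose a (j : int) := Num.max `|complex.Re (h j)| `|complex.Im (h j)|.
exists (Num.max M (Num.max (a n.+1%:Z) (a (- n.+1%:Z)))) => j jn.
have [/IH[h1 h2]|nj] := leP `|j| n%:Z; first by rewrite !le_max h1 h2.
have [->|->] : j = n.+1%:Z \/ j = - n.+1%:Z by lia.
  by rewrite /a !le_max !lexx !orbT.
by rewrite /a !le_max !lexx !orbT.
Qed.

(** On the support of f the absolute value takes only finitely many values p^j, so an arbitrary
    radial factor is bounded there, whatever its behaviour near 0. *)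
Lemma test1_radial (h : rat -> C) f : test1 f ->
  (exists2 e : rat, 0 < e & forall z, padic_abs z < e -> f z = 0) ->
  test1 (fun z => h (padic_abs z) * f z).
Proof.
move=> [lf [k fk] [M fM]] [e e0 fe].
have [n ne] := ratP_arch e0.
have [L hL] := bounded_int (fun j => h (P ^ j)) (maxn n `|k|).
split.
- move=> x; have [->|x0] := eqVneq x 0.
    by exists e => // y; rewrite subr0 => ye; rewrite !fe ?padic_abs0// !mulr0.
  apply: (loc_cst2 *%R) => //; apply: (loc_cstT h); exact: loc_cst_abs.
- by exists k => z /fk ->; rewrite mulr0.
- exists (L * M + L * M) => z.
  have [M0 L0] : 0 <= M /\ 0 <= L.
    have [M0 _] := fM 0; have [|L0 _] := hL 0; first by rewrite normr0; lia.
    by split; [exact: le_trans M0|exact: le_trans L0].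
  have [fz|fz] := eqVneq (f z) 0.
    by rewrite fz mulr0 normr0 addr_ge0 ?mulr_ge0.
  have z0 : z != 0.
    by apply: contra_neq fz => ->; rewrite fe ?padic_abs0.
  have [j zj] := padic_abs_exprz z0.
  have jn : `|j| <= (maxn n `|k|)%:Z.
    have jk : j <= k.
      rewrite leNgt; apply: contra_neqN fz => kj; apply: fk.
      by rewrite /pball /= zj ler_eXz2l//; apply/negP; rewrite -ltNge.
    have nj : - n%:Z <= j.
      rewrite leNgt; apply: contra_neqN fz => kj; apply: fe.
      rewrite zj (lt_trans _ ne)// exprnP invr_expz ltr_eXz2l//.
    by lia.
  have [h1 h2] := hL j jn; have [f1 f2] := fM z.
  rewrite zj; case: (f z) (h _) f1 f2 h1 h2 => a b [c d] /= *.
  split; first rewrite -[_ - _]/(c * a + - (d * b)).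
    by rewrite (le_trans (ler_normD _ _))// normrN !normrM lerD// ler_pM.
  by rewrite (le_trans (ler_normD _ _))// !normrM lerD// ler_pM.
Qed.

Variables (h : rat -> C) (c0 : C).

(** f - f(0) 1_(B_0): its restrictions to the unit ball and to the complement are the two integrands
    of [power_functional], so that one integral over Q_p replaces two. *)
Definition regularize f z : C := - f 0 * wave R 0 0 0 z + f z.

Lemma wave_ball k z : wave R 0 k 0 z = if padic_abs z <= P ^ k then 1 else 0.
Proof. by rewrite /wave subr0 mul0r chi0. Qed.

Lemma test1_regularize f : test1 f -> test1 (regularize f).
Proof. by move=> tf; apply: test1D => //; apply: test1Z; exact: test1_wave. Qed.

Lemma regularize_near0 f : test1 f ->
  exists2 e : rat, 0 < e & forall z, padic_abs z < e -> regularize f z = 0.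
Proof.
move=> [lf _ _]; have [e e0 fe] := lf 0; exists (Num.min e 1).
  by rewrite lt_min e0 ltr01.
move=> z; rewrite lt_min => /andP[ze z1]; rewrite /regularize wave_ball expr0z.
by rewrite (ltW z1) mulr1 fe ?subr0// addNr.
Qed.

Lemma test1_radial_reg f : test1 f ->
  test1 (fun z => h (padic_abs z) * regularize f z).
Proof.
move=> tf; apply: test1_radial; first exact: test1_regularize.
exact: regularize_near0.
Qed.

(* Each Riesz kernel has this form up to a scalar: h is the radial density
   (0 for delta) and c0 is the value on the indicator of the unit ball. *)
Definition radial f : C :=
  cintegral mu setT (fun z => h (padic_abs z) * regularize f z) + f 0 * c0.

Lemma linear_radial : linear_test1 radial.
Proof.
move=> c f g tf tg; rewrite /radial mulrDr addrACA.
rewrite -(linear_cintegral mu_haar) ?mulrA -?mulrDl; try exact: test1_radial_reg.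
congr (_ + _); apply: eq_cintegral => z _; rewrite /regularize; ring.
Qed.

Lemma radial_sphere f k : test1 f -> (forall z, padic_abs z != P ^ k -> f z = 0) ->
  radial f = h (P ^ k) * cintegral mu setT f.
Proof.
move=> tf fk; have f0 : f 0 = 0 by rewrite fk// padic_abs0 lt_eqF ?exprz_gt0.
rewrite /radial f0 mul0r addr0 -(addr0 (h (P ^ k) * _)).
have <- : cintegral mu setT (fun=> 0) = 0 by rewrite /cintegral /= !Rintegral0.
rewrite -(linear_cintegral mu_haar) ?addr0//; last exact: test1_0.
apply: eq_cintegral => z _; rewrite /regularize f0 oppr0 mul0r add0r addr0.
by have [->//|/fk ->] := eqVneq (padic_abs z) (P ^ k); rewrite !mulr0.
Qed.

Lemma radial_ball0 : radial (wave R 0 0 0) = c0.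
Proof.
have w0 : wave R (0 : Qp) 0 0 0 = 1 by rewrite wave_ball padic_abs0 expr0z ler01.
rewrite /radial /regularize w0 mul1r.
under eq_fun do rewrite mulN1r addNr mulr0.
by rewrite /cintegral /= !Rintegral0 add0r.
Qed.

(** The two waves differ by a function supported on the sphere |z| = p^(k+1), where the density is
    constant. *)
Lemma radial_wave_step k b : radial (wave R 0 (k + 1) b) = radial (wave R 0 k b) +
  h (P ^ (k + 1)) *
    (cintegral mu setT (wave R 0 (k + 1) b) - cintegral mu setT (wave R 0 k b)).
Proof.
have t1 := test1_wave R 0 (k + 1) b; have t2 := test1_wave R 0 k b.
pose f z := -1 * wave R 0 k b z + wave R 0 (k + 1) b z.
have tf : test1 f by apply: test1D => //; exact: test1Z.
have : radial f = h (P ^ (k + 1)) * cintegral mu setT f.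
  apply: radial_sphere => // z zk; rewrite /f /wave subr0.
  have [zk1|zk1] := leP (padic_abs z) (P ^ k).
    rewrite (le_trans zk1) ?mulN1r ?addNr// ler_eXz2l//; lia.
  case: ifP => zk2; rewrite ?mulr0 ?addr0//.
  have z0 : z != 0 by rewrite -padic_abs_gt0 (lt_trans _ zk1)// exprz_gt0.
  have [j zj] := padic_abs_exprz z0.
  move: zk zk1 zk2; rewrite zj ltr_eXz2l// ler_eXz2l// => /eqP + kj jk.
  by have -> : j = k + 1 by lia.
rewrite linear_radial// (linear_cintegral mu_haar)// !mulN1r => e.
by move: e; rewrite [X in _ = _ * X]addrC => <-; rewrite addNKr.
Qed.

(** A ball that misses 0 lies in one sphere, so the functional is a multiple of the Haar integral,
    which oscillation annihilates. *)
Lemma radial_wave_out x N b : P ^ N < padic_abs x -> 1 < padic_abs b * P ^ N ->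
  radial (wave R x N b) = 0.
Proof.
move=> xN bN; have x0 : x != 0 by rewrite -padic_abs_gt0 (lt_trans _ xN)// exprz_gt0.
have [j xj] := padic_abs_exprz x0.
rewrite (@radial_sphere _ j); first last.
- move=> z zj; rewrite /wave; case: ifPn => // zx; case/eqP: zj.
  by rewrite -[z](subrK x) padic_absDl// (le_lt_trans zx).
- exact: test1_wave.
by rewrite cintegral_wave// leNgt bN !mulr0.
Qed.

(* W k stands for the value |b|^(-a), |b| = p^(-k), of the functional on the
   waves of frequency b; the hypotheses say that W k + h(p^(k+1)) p^k follows
   the recursion in k satisfied by the values on indicators of balls. *)
Variable W : int -> C.
Hypothesis W0 : W 0 + h (P ^ 1) = c0.
Hypothesis WS : forall k, W (k + 1) + h (P ^ (k + 2)) * (p%:R ^ (k + 1))%:C =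
  W k + h (P ^ (k + 1)) * (p%:R ^ (k + 1))%:C.

(** Both sides agree at k = 0 by [W0] and have equal increments by [WS], the sphere of radius
    p^(k+1) having volume p^(k+1) - p^k. Negative k are reached by running the recursion
    backwards. *)
Lemma radial_ball k : radial (wave R 0 k 0) = W k + h (P ^ (k + 1)) * (p%:R ^ k)%:C.
Proof.
have step l : radial (wave R 0 (l + 1) 0) = radial (wave R 0 l 0) +
    h (P ^ (l + 1)) * ((p%:R ^ (l + 1))%:C - (p%:R ^ l)%:C).
  by rewrite radial_wave_step !cintegral_wave// !mulr0 padic_abs0 !mul0r ler01 chi0 !mul1r.
elim/int_ind: k => [|n IH|n IH].
- by rewrite radial_ball0 -W0 expr0z mulr1.
- rewrite -addn1 PoszD step IH.
  have -> : n%:Z + 1 + 1 = n%:Z + 2 by lia.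
  by rewrite WS; ring.
- have := step (- n.+1%:Z); have := WS (- n.+1%:Z).
  have -> : - n.+1%:Z + 1 = - n%:Z by lia.
  have -> : - n.+1%:Z + 2 = - n%:Z + 1 by lia.
  rewrite IH => -> /eqP; rewrite -subr_eq => /eqP <-; ring.
Qed.

Lemma radial_wave0 k b (n : nat) : padic_abs b = P ^ (- k) ->
  radial (wave R 0 (k + n.+1%:Z) b) = W k.
Proof.
move=> bk; elim: n => [|n IH].
  (* From radius p^k to p^(k+1) the integral of the wave drops from p^k to 0. *)
  rewrite radial_wave_step !cintegral_wave// bk -!expfzDr ?gt_eqF// addKr addNr.
  rewrite expr0z lexx (mulr0 b) chi0 !mul1r expr1z leNgt P1 /= sub0r.
  have -> : wave R 0 k b = wave R 0 k 0.
    apply/funext => z; rewrite wave_ball /wave subr0; case: ifP => // zk.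
    by apply: chi_int; rewrite padic_absM bk -invr_expz mulrC ler_pdivrMr ?exprz_gt0// mul1r.
  by rewrite radial_ball mulrN addrK.
have -> : k + n.+2%:Z = k + n.+1%:Z + 1 by lia.
(* Beyond radius p^k both integrals in the step vanish, so the value no longer moves. *)
rewrite radial_wave_step IH !cintegral_wave// bk -!expfzDr ?gt_eqF// (mulr0 b) chi0.
have big l : 0 < l -> (P ^ l <= 1) = false.
  by move=> l0; rewrite -[X in _ <= X](expr0z P) ler_eXz2l//; apply/negbTE; rewrite -ltNge.
by rewrite !big ?subrr ?mulr0 ?addr0//; lia.
Qed.

Lemma radial_wave x N b k : padic_abs b = P ^ (- k) -> k < N ->
  radial (wave R x N b) = if padic_abs x <= P ^ N then W k else 0.
Proof.
move=> bk kN; case: ifPn => [xN|]; last first.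
  rewrite -ltNge => xN; apply: radial_wave_out => //.
  by rewrite bk -expfzDr ?gt_eqF// -[X in X < _](expr0z P) ltr_eXz2l//; lia.
(* Every point of an ultrametric ball is a centre of it. *)
have -> : wave R x N b = wave R 0 N b.
  apply/funext => z; rewrite /wave subr0.
  suff -> : (padic_abs (z - x) <= P ^ N) = (padic_abs z <= P ^ N) by [].
  apply/idP/idP => zN; last by rewrite (le_trans (padic_absB _ _))// ge_max zN.
  by rewrite -[z](subrK x) (le_trans (padic_absD _ _))// ge_max zN.
have -> : N = k + (`|N - k|.-1).+1%:Z by lia.
exact: radial_wave0.
Qed.

End RadialFunctional.

(** * The delta, logarithmic and power kernels as radial functionals *)

Section RieszKernel.
Variables (R : realType) (p : nat) (p_pr : prime p).
Local Notation Qp := (padic p_pr).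
Local Notation C := (R[i]).
Local Notation P := (p%:R : rat).
Local Notation pR := (p%:R : R).
Local Notation B := (@pball p p_pr).
Variable mu : {measure set Qp -> \bar R}.
Hypothesis mu_haar : haar_measure mu.
Local Open Scope complex_scope.
Implicit Types (f g : Qp -> C) (k l m N : int) (x b z : Qp) (a : C).

Let P1 : 1 < P := ratP_gt1 p_pr.
Let P0 : 0 < P. Proof. exact: lt_trans P1. Qed.
Let pR1 : 1 < pR. Proof. by rewrite ltr1n prime_gt1. Qed.
Let pR0 : 0 < pR. Proof. exact: lt_trans pR1. Qed.

Lemma ratr_Pz k : ratr (P ^ k) = pR ^ k.
Proof. by rewrite fmorphXz /= ratr_nat. Qed.

Lemma padic_norm_le1 : [set z : Qp | padic_norm R z <= 1] = B 0.
Proof.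
have E z : (padic_norm R z <= 1) = (padic_abs z <= P ^ 0).
  by rewrite expr0z -(ler_rat R) rmorph1.
by apply/seteqP; split=> z; rewrite /pball /= E.
Qed.

Definition riesz_power a (r : rat) : C := cpow (ratr r) (a - 1).

Lemma power_functional_radial a f : test1 f -> power_functional mu a f =
  radial mu (riesz_power a) ((1 - p%:R^-1) / (1 - cpow pR (- a))) f.
Proof.
move=> tf; rewrite /power_functional /radial padic_norm_le1; congr (_ + _).
have mB := measurable_pball (p_pr := p_pr) 0.
rewrite -(cintegral_setC (D := B 0)) //; last first.
  by apply: test1_cintegrable => //; exact: test1_radial_reg.
congr (_ + _); apply: eq_cintegral => z /= zB; congr (_ * _);
  rewrite /regularize wave_ball.
  by rewrite zB mulr1 addrC.
by rewrite ifF ?mulr0 ?add0r//; apply/negP.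
Qed.

Definition riesz_log (r : rat) : C :=
  (- ((1 - p%:R^-1) / ln p%:R * ln (ratr r)))%:C.

Lemma ln_exprz (x : R) k : 0 < x -> ln (x ^ k) = k%:~R * ln x.
Proof.
move=> x0; case: k => n; first by rewrite -exprnP lnXn// mulr_natl.
rewrite -[x ^ _]/((x ^+ n.+1)^-1) lnV ?posrE ?exprn_gt0// lnXn//.
by rewrite NegzE mulrNz mulNr mulr_natl.
Qed.

Lemma lnP_neq0 : ln pR != 0.
Proof. by rewrite gt_eqF// ln_gt0. Qed.

Lemma eseries_ltn (c : R) (m : nat) :
  (\sum_(0 <= n <oo) (c * (n < m)%N%:R)%:E)%E = (c * m%:R)%:E.
Proof.
apply: lim_near_cst => //; exists m => // N /= mN; rewrite sumEFin; congr EFin.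
transitivity (c * (minn N m)%:R); last by rewrite (minn_idPr mN).
elim: (N) => [|k IH]; first by rewrite big_nil min0n mulr0.
rewrite big_nat_recr//= IH -mulrDr -natrD; congr (_ * _%:R).
lia.
Qed.

Lemma log_sum z :
  (\sum_(0 <= n <oo) ((1 - pR^-1) * \1_(B (- n.+1%:Z) `\ 0) z)%:E)%E =
  ((if padic_abs z <= 1 then - ((1 - pR^-1) / ln pR * ln (ratr (padic_abs z))) else 0))%:E.
Proof.
have [->|z0] := eqVneq z 0.
  rewrite padic_abs0 ler01 rmorph0 (ln0 (lexx 0)) mulr0 oppr0.
  rewrite eseries0// => n _ _; rewrite indicE memNset ?mulr0// => -[_]; exact.
have [j zj] := padic_abs_exprz z0; rewrite zj ratr_Pz ln_exprz//.
(* m counts the n >= 0 with j <= -(n + 1): there are -j of them if j <= 0, and none otherwise. *)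
pose m : nat := if j <= 0 then `|j|%N else 0%N.
under eq_eseriesr => n _.
  rewrite indicE (_ : (z \in _) = (n < m)%N); first over.
  apply/idP/idP; rewrite inE /pball /= zj => zn.
    by have [+ _] := zn; rewrite ler_eXz2l// /m; case: ifP; lia.
  split; last by apply/eqP.
  by rewrite ler_eXz2l//; move: zn; rewrite /m; case: ifP; lia.
have j1 : (P ^ j <= 1) = (j <= 0) by rewrite -[X in _ <= X](expr0z P) ler_eXz2l.
rewrite eseries_ltn; congr (_%:E); rewrite j1 /m.
case: ifP => j0; last by rewrite mulr0.
have -> : `|j|%:R = - j%:~R :> R by rewrite -mulrNz -(lez0_abs j0).
by field; rewrite lnP_neq0 gt_eqF.
Qed.

Lemma haar_pball_punctured k : mu (B k `\ 0) = (pR ^ k)%:E.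
Proof.
rewrite -(haar_pball mu_haar).
have E : B k = (B k `\ 0) `|` [set 0].
  rewrite setDKU// => _ ->.
  by rewrite /pball /= padic_abs0 exprz_ge0// ltW.
have m1 : measurable (B k `\ 0).
  by apply: measurableD; [exact: measurable_pball|exact: measurable_padic1].
rewrite [in RHS]E measureU//.
- by rewrite -[LHS]adde0; congr (_ + _)%E; exact/esym/(haar0 mu_haar).
- exact: measurable_padic1.
- by apply/seteqP; split=> // x [[_ x0] /x0].
Qed.

(* On the unit ball, - log_p |z| is the sum over n of the indicators of the
   punctured balls of radius p^(-(n+1)); this is exact even at 0, where ln is 0. *)
Lemma integral_log :
  (\int[mu]_z ((if padic_abs z <= 1 then
    - ((1 - pR^-1) / ln pR * ln (ratr (padic_abs z))) else 0))%:E = (pR^-1)%:E)%E.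
Proof.
have c0 : 0 <= 1 - pR^-1 by rewrite subr_ge0 invf_le1// ltW.
under eq_integral do rewrite -log_sum.
have mB n : measurable (B (- n%:Z) `\ 0).
  by apply: measurableD; [exact: measurable_pball|exact: measurable_padic1].
rewrite integral_nneseries//; last first.
- by move=> n x _; rewrite lee_fin mulr_ge0.
- move=> n; apply/measurable_EFinP; apply: measurable_funM.
    exact: measurable_cst.
  by apply: measurable_indic; exact: (mB n.+1).
(* The n-th punctured ball contributes (1 - 1/p) p^(-(n+1)), and the geometric series sums to
   1/p. *)
transitivity (\sum_(0 <= n <oo) ((1 - pR^-1) * pR^-1 * pR^-1 ^+ n)%:E)%E.
  apply: eq_eseriesr => n _; under eq_integral do rewrite EFinM.
  rewrite ge0_integralZl_EFin//.
  - rewrite integral_indic ?setIT; [|by []|exact: (mB n.+1)]; rewrite haar_pball_punctured -EFinM; congr EFin.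
    by rewrite -mulrA -exprS exprVn -invr_expz -exprnP.
  - apply/measurable_EFinP; apply: measurable_indic; exact: (mB n.+1).
have geo : series (geometric ((1 - pR^-1) * pR^-1) pR^-1) @ \oo --> pR^-1.
  have := @cvg_geometric_series _ ((1 - pR^-1) * pR^-1) pR^-1.
  rewrite ger0_norm ?invr_ge0 ?ltW// invf_lt1// pR1 => /(_ isT).
  by rewrite mulrAC mulfV ?mul1r// gt_eqF// subr_gt0 invf_lt1.
rewrite -[in RHS](cvg_lim _ geo)// -EFin_lim; last by apply/cvg_ex; exists pR^-1.
by congr (limn _); apply/funext => n /=; rewrite sumEFin.
Qed.

(** The logarithm is unbounded at 0, so the criterion for test functions does not apply;
    integrability follows from nonnegativity on the unit ball and the finite integral just
    computed. *)
Lemma cintegrable_log : cintegrable mu setT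
  (fun z => riesz_log (padic_abs z) * wave R 0 0 0 z) /\
  cintegral mu setT (fun z => riesz_log (padic_abs z) * wave R 0 0 0 z) = (pR^-1)%:C.
Proof.
set F := fun z : Qp => if padic_abs z <= 1 then
  - ((1 - pR^-1) / ln pR * ln (ratr (padic_abs z))) else 0.
have E : (fun z => riesz_log (padic_abs z) * wave R 0 0 0 z) = (fun z => (F z)%:C).
  apply/funext => z; rewrite wave_ball expr0z /F /riesz_log.
  by case: ifP; rewrite ?mulr1 ?mulr0.
have iF := integral_log; rewrite -/F in iF.
have F0 z : 0 <= F z.
  rewrite /F; case: ifP => // z1; rewrite oppr_ge0 mulr_ge0_le0//.
    by rewrite divr_ge0// ?subr_ge0 ?invf_le1 ?ln_ge0// ltW.
  by move: z1; rewrite -(ler_rat R) rmorph1 => /ln_le0.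
have mF : measurable_fun setT F.
  apply: measurable_loc_cst => // x x0.
  exact: (loc_cstT (fun r => if r <= 1 then - ((1 - pR^-1) / ln pR * ln (ratr r)) else 0))
    (loc_cst_abs x0).
have IF : mu.-integrable setT (EFin \o F).
  apply/integrableP; split; first exact/measurable_EFinP.
  under eq_integral do rewrite /= ger0_norm//.
  by rewrite iF ltry.
rewrite E; split; first by split=> //=; exact: integrable0.
by rewrite /cintegral /= Rintegral0 /Rintegral iF.
Qed.

Lemma cpow_mu_period_norm j k : cpow (pR ^ k) (mu_period R p j) = 1.
Proof.
rewrite cpow_exprz//; have /(mu_periodP _ p_pr) -> : exists i, mu_period R p j = mu_period R p i.
  by exists j.
by rewrite exp1rz.
Qed.

(** Write f as [regularize f] plus f(0) 1_(B_0); the second term contributes f(0)/p, whence the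
    constant c0. *)
Lemma riesz_log_radial f : test1 f ->
  cintegral mu setT (fun z => riesz_log (padic_abs z) * f z) =
  radial mu riesz_log (p%:R^-1) f.
Proof.
move=> tf; have [ciw cw] := cintegrable_log.
have -> : (p%:R^-1 : C) = (pR^-1)%:C by rewrite fmorphV rmorph_nat.
rewrite /radial -cw -cintegralZ// -cintegralD//.
- by apply: eq_cintegral => z _; rewrite /regularize; ring.
- by apply: test1_cintegrable => //; exact: test1_radial_reg.
- exact: cintegrableZ.
Qed.

(** A common presentation of the three kinds of kernel: the last two conditions are [W0] and [WS]
    for W k = G p^(k a), with G equal to Gamma_p(a) for powers and to 1 otherwise. *)
Variant riesz_spec a : ((Qp -> C) -> C) -> Prop :=
  RieszRadial (h : rat -> C) (c0 G : C) (T : (Qp -> C) -> C) of G != 0 &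
    (forall f, test1 f -> T f = radial mu h c0 f / G) &
    G + h (P ^ 1) = c0 &
    (forall k, G * cpow (pR ^ (k + 1)) a + h (P ^ (k + 2)) * (p%:R ^ (k + 1))%:C =
      G * cpow (pR ^ k) a + h (P ^ (k + 1)) * (p%:R ^ (k + 1))%:C) : riesz_spec a T.

Lemma riesz_kernelP a : riesz_spec a (riesz_kernel mu a).
Proof.
have pC0 : (p%:R : C) != 0 by rewrite pnatr_eq0 -lt0n prime_gt0.
have pRC k : (pR ^ k)%:C = p%:R ^ k :> C by rewrite fmorphXz /= rmorph_nat.
have cR k c : cpow (ratr (P ^ k)) c = cpow pR c ^ k by rewrite ratr_Pz cpow_exprz.
case: (pselect (exists j, a = mu_period R p j)) => [aj|naj].
  (* delta has zero density and value 1 on the unit ball; p^(k a) = 1 for every k. *)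
  apply: (@RieszRadial _ (fun=> 0) 1 1); rewrite ?oner_neq0 ?addr0//.
  - move=> f tf; rewrite /riesz_kernel asboolT// /radial.
    under eq_fun do rewrite mul0r.
    by rewrite /cintegral /= Rintegral0 add0r mulr1 divr1.
  - move=> k; case: aj => j ->.
    by rewrite !cpow_mu_period_norm !mul0r.
case: (pselect (exists j, a = 1 + mu_period R p j)) => [a1j|na1j].
  (* Here p^(k a) = p^k, and the density at radius p is -(1 - 1/p), consistent with c0 = 1/p. *)
  apply: (@RieszRadial _ riesz_log p%:R^-1 1); rewrite ?oner_neq0//.
  - move=> f tf; rewrite /riesz_kernel asboolF// asboolT// divr1.
    by rewrite -riesz_log_radial.
  - rewrite /riesz_log ratr_Pz expr1z divfK ?lnP_neq0//.
    by rewrite opprB rmorphB fmorphV /= rmorph_nat addrCA subrr addr0.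
  - move=> k; case: a1j => j ->.
    rewrite !cpowD !cpow_mu_period_norm !cpowx1 ?exprz_gt0// !mulr1 !mul1r.
    rewrite /riesz_log !ratr_Pz !ln_exprz//.
    rewrite -!rmorphM -!rmorphD; congr (_%:C).
    have pk : pR ^ (k + 1) = pR ^ k * pR by rewrite expfzDr ?gt_eqF// expr1z.
    rewrite pk !intrD; have := lnP_neq0; have p0 : pR != 0 by rewrite gt_eqF.
    move: (ln pR) (pR ^ k) (k%:~R : R) => L q r L0; field.
    by rewrite p0 L0.
(* Excluding the exceptional exponents means q is neither 1 nor p, i.e. the denominator and the
   numerator of Gamma_p(a) are nonzero. *)
pose q := cpow pR a.
have q0 : q != 0 by exact: cpow_neq0.
have q1 : q != 1.
  by apply/eqP => /(mu_periodP _ p_pr).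
have cp1 : cpow pR (1 : C) = p%:R by rewrite cpowx1// rmorph_nat.
have qa1 : cpow pR (a - 1) = q / p%:R by rewrite cpowD cpowN cp1.
have qp : q != p%:R.
  apply/eqP => qp; apply: na1j; have : cpow pR (a - 1) = 1 by rewrite qa1 qp mulfV.
  by move/(mu_periodP _ p_pr) => [j aj]; exists j; rewrite -aj addrCA subrr addr0.
have G0 : Gammap p a != 0.
  rewrite /Gammap qa1 cpowN -/q mulf_neq0 ?invr_eq0// subr_eq0 eq_sym.
    by apply: contra_neq qp => /(congr1 ( *%R^~ p%:R)); rewrite divfK// mul1r.
  by rewrite invr_eq1.
apply: (@RieszRadial _ (riesz_power a) ((1 - p%:R^-1) / (1 - cpow pR (- a))) (Gammap p a)) => //.
- move=> f tf; rewrite /riesz_kernel !asboolF//.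
  by rewrite power_functional_radial.
- rewrite /riesz_power cR expr1z qa1 /Gammap qa1 cpowN -/q.
  by field; rewrite q0 subr_eq0 q1 pC0.
- move=> k; rewrite /riesz_power !cR !cpow_exprz// qa1 /Gammap qa1 cpowN -/q pRC.
  have -> : k + 2 = k + 1 + 1 by rewrite -addrA.
  have qk1 (x : C) : x != 0 -> x ^ (k + 1 + 1) = x ^ k * x * x.
    by move=> x0; rewrite !expfzDr// expr1z.
  have qk2 (x : C) : x != 0 -> x ^ (k + 1) = x ^ k * x.
    by move=> x0; rewrite !expfzDr// expr1z.
  have qp0 : q / p%:R != 0 by rewrite mulf_neq0 ?invr_eq0.
  (* Only the powers q^k and (q/p)^k remain, so the recursion becomes a rational identity in
     independent atoms. *)
  have -> : (p%:R ^ (k + 1) : C) = q ^ (k + 1) / (q / p%:R) ^ (k + 1).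
    apply: (mulIf (expfz_neq0 (k + 1) qp0)); rewrite divfK ?expfz_neq0//.
    by rewrite -expfzMl mulrC divfK.
  rewrite qk1// !qk2//; have : (q / p%:R) ^ k != 0 by rewrite expfz_neq0.
  move: ((q / p%:R) ^ k) (q ^ k) => u v u0; field.
  by rewrite u0 pC0 subr_eq0 q1 q0.
Qed.

Lemma linear_riesz a : linear_test1 (riesz_kernel mu a).
Proof.
case: riesz_kernelP => h c0 G T G0 TE _ _ c f g tf tg.
rewrite !TE//; last by apply: test1D => //; exact: test1Z.
by rewrite linear_radial// mulrDl mulrA.
Qed.

Lemma riesz_wave a x N b k : padic_abs b = P ^ (- k) -> k < N ->
  riesz_kernel mu a (wave R x N b) = if padic_abs x <= P ^ N then cpow (pR ^ k) a else 0.
Proof.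
case: riesz_kernelP => h c0 G T G0 TE h0 hS bk kN.
rewrite TE; last exact: test1_wave.
rewrite (@radial_wave _ _ _ _ _ _ _ (fun k => G * cpow (pR ^ k) a) _ _ _ _ _ k)//.
  by case: ifP => _; rewrite ?mul0r// mulrAC mulfV// mul1r.
by rewrite expr0z cpow1x mulr1.
Qed.

End RieszKernel.

(** * Several variables *)

Section SeveralVariables.
Variables (R : realType) (p : nat) (p_pr : prime p) (n : nat).
Local Notation Qp := (padic p_pr).
Local Notation Qpn := 'rV[Qp]_n.
Local Notation C := (R[i]).
Local Notation P := (p%:R : rat).
Local Notation pR := (p%:R : R).
Local Open Scope complex_scope.
Implicit Types (m N : int) (x y c : Qpn) (psi : Qpn -> C).

Let P1 : 1 < P := ratP_gt1 p_pr.
Let P0 : 0 < P. Proof. exact: lt_trans P1. Qed.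

Lemma direct_product_sum (T : 'I_n -> (Qp -> C) -> C) (K : Type) (l : seq K)
    (a : K -> C) (u : K -> 'I_n -> Qp -> C) :
  (forall j, linear_test1 (T j)) -> (forall k j, test1 (u k j)) ->
  direct_product T (fun x => \sum_(k <- l) a k * \prod_j u k j (x 0 j)) =
  \sum_(k <- l) a k * \prod_j T j (u k j).
Proof.
move=> Tl tu; rewrite /direct_product.
set phi := (X in foldr _ X).
(* Invariant of the fold: the variables listed in s have been integrated out, the others are still
   evaluated at x. Uniqueness of s keeps each functional from acting twice. *)
have H (s : seq 'I_n) : uniq s -> forall x,
    foldr (fun j (Phi : Qpn -> C) x => T j (fun z => Phi (set_coord x j z))) phi s x =
    \sum_(k <- l) a k * \prod_j (if j \in s then T j (u k j) else u k j (x 0 j)).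
  elim: s => [_ x|i s IH /= /andP[i_s us] x]; first by [].
  under eq_fun do rewrite IH//.
  pose r k := \prod_(j | j != i) (if j \in s then T j (u k j) else u k j (x 0 j)).
  transitivity (T i (fun z => \sum_(k <- l) (a k * r k) * u k i z)).
    congr (T i _); apply/funext => z; apply: eq_bigr => k _.
    rewrite (bigD1 i)//= (negPf i_s) /set_coord mxE eqxx.
    rewrite -mulrA [r k * _]mulrC; congr (_ * (_ * _)).
    by apply: eq_bigr => j ji; rewrite mxE (negPf ji).
  rewrite linear_test1_sum//; apply: eq_bigr => k _.
  rewrite [in RHS](bigD1 i)//= mem_head -mulrA [r k * _]mulrC; congr (_ * (_ * _)).
  by apply: eq_bigr => j ji; rewrite in_cons (negPf ji).
rewrite H ?enum_uniq//; apply: eq_bigr => k _; congr (_ * _).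
by apply: eq_bigr => j _; rewrite mem_enum.
Qed.

Definition box N c : set Qpn := [set x | forall j, padic_abs (x 0 j - c 0 j) <= P ^ N].

Lemma box_refl N x : box N x x.
Proof. by move=> j; rewrite subrr padic_abs0 exprz_ge0// ltW. Qed.

Lemma box_sym N x y : box N x y -> box N y x.
Proof. by move=> xy j; rewrite -opprB padic_absN. Qed.

Lemma box_trans N x y c : box N x y -> box N y c -> box N x c.
Proof.
move=> xy yc j; have -> : c 0 j - x 0 j = (c 0 j - y 0 j) + (y 0 j - x 0 j).
  by rewrite addrA subrK.
by rewrite (le_trans (padic_absD _ _))// ge_max yc xy.
Qed.

Lemma box_le N m x : N <= m -> box N x `<=` box m x.
Proof. by move=> Nm y xy j; rewrite (le_trans (xy j))// ler_eXz2l. Qed.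

Lemma nbhs_boxP x (A : set Qpn) : nbhs x A <-> exists N, box N x `<=` A.
Proof.
rewrite nbhs_ballP; split=> [[e e0 xA]|[N xA]].
  have [m me] := ratP_arch p_pr e0; exists (- m%:Z) => y xy; apply: xA.
  split=> // i j; rewrite ballEmdist/= /mdist/= /padic_dist -opprB padic_absN.
  by rewrite (ord1 i) (le_lt_trans (xy j))// -invr_expz -exprnP.
exists (P ^ N); first by rewrite /= exprz_gt0.
move=> y [_ xy]; apply: xA => j; have := xy 0 j.
by rewrite ballEmdist/= /mdist/= /padic_dist -opprB padic_absN => /ltW.
Qed.

Lemma open_box N c : open (box N c).
Proof.
rewrite openE => x cx; apply/nbhs_boxP; exists N => y xy; exact: box_trans xy.
Qed.

Lemma compact_boxes (K : set Qpn) (M : Qpn -> int) : compact K ->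
  exists L : seq Qpn, forall x, K x -> exists2 c, c \in L & box (M c) c x.
Proof.
rewrite compact_cover => cK.
have [|x Kx|D _ KD] := cK Qpn setT (fun c => box (M c) c).
- by move=> c _; exact: open_box.
- by exists x => //; exact: box_refl.
by exists (finmap.enum_fset D) => x /KD[c cD xc]; exists c.
Qed.

Lemma box_set_coord N c j : padic_abs (c 0 j) <= P ^ N -> box N c (set_coord c j 0).
Proof.
move=> cj i; rewrite mxE; case: eqP => [->|_]; first by rewrite sub0r padic_absN.
by rewrite subrr padic_abs0 exprz_ge0// ltW.
Qed.

Definition box_cst N psi := forall x y, box N x y -> psi y = psi x.

(** Compactness of the support makes local constancy uniform: N is the least of finitely many local
    radii. The support then stays away from the hyperplanes, where psi is 0. *)
Lemma lizorkin_box psi : lizorkin_psi psi -> exists N,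
  [/\ box_cst N psi, forall x, psi x != 0 -> forall j, P ^ N < padic_abs (x 0 j) &
    exists L : seq Qpn, forall x, psi x != 0 -> exists2 c, c \in L & box N c x].
Proof.
move=> [[lpsi cpsi] psi0].
have /choice[M psiM] : forall x, exists N, forall y, box N x y -> psi y = psi x.
  by move=> x; have /nbhs_boxP[N xN] := lpsi x; exists N.
have inK x : psi x != 0 -> closure [set x | psi x != 0] x.
  by move=> x0; apply: subset_closure.
have [L KL] := compact_boxes M cpsi.
have [N NL] : exists N, forall c, c \in L -> N <= M c.
  elim: (L) => [|c s [N IH]]; first by exists 0.
  exists (Num.min N (M c)) => d; rewrite in_cons => /predU1P[->|/IH Nd].
    by rewrite ge_min lexx orbT.
  by rewrite ge_min Nd.
have cst x y : box N x y -> psi x != 0 -> psi y = psi x.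
  move=> xy /inK/KL[c cL cx]; rewrite (psiM c x)// (psiM c y)//.
  by apply: box_trans cx _; apply: box_le xy; exact: NL.
have Ncst : box_cst N psi.
  move=> x y xy; have [x0|x0] := eqVneq (psi x) 0; last exact: cst.
  have [y0|y0] := eqVneq (psi y) 0; first by rewrite x0.
  by rewrite -(cst y x)//; exact: box_sym.
exists N; split=> // [x x0 j|].
  (* If |x_j| <= p^N, replacing x_j by 0 stays in the box of x and reaches a hyperplane. *)
  rewrite ltNge; apply: contra_neqN x0 => xj.
  by rewrite -(Ncst _ _ (box_set_coord xj)) (psi0 j)// mxE eqxx.
(* A second cover, now by boxes of the common radius p^N. *)
have [L' KL'] := compact_boxes (fun=> N) cpsi.
by exists L' => x /inK/KL'.
Qed.

Definition comb N (l : seq (C * Qpn)) x : C :=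
  \sum_(k <- l) k.1 * \prod_j wave R (k.2 0 j) N 0 (x 0 j).

Lemma prod_wave_box N c x :
  \prod_j wave R (c 0 j) N 0 (x 0 j) = if `[< box N c x >] then 1 else 0.
Proof.
case: asboolP => [cx|/existsNP[j cx]].
  by apply: big1 => j _; rewrite /wave cx mul0r chi0.
have wj : wave R (c 0 j) N 0 (x 0 j) = 0 by rewrite /wave ifF//; apply/negP.
by rewrite (bigD1 j)//= wj mul0r.
Qed.

(** Induction on the cover: boxes of one radius are equal or disjoint, so subtracting psi(c) times
    the indicator of the box of c clears that box and leaves psi unchanged elsewhere. *)
Lemma box_comb N (L : seq Qpn) psi : box_cst N psi ->
  (forall x, psi x != 0 -> forall j, P ^ N < padic_abs (x 0 j)) ->
  (forall x, psi x != 0 -> exists2 c, c \in L & box N c x) ->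
  exists2 l : seq (C * Qpn), (forall k, k \in l -> forall j, P ^ N < padic_abs (k.2 0 j)) &
    psi = comb N l.
Proof.
elim: L psi => [|c L IH] psi Npsi psi0 psiL.
  exists [::] => //; apply/funext => x; rewrite /comb big_nil.
  by apply/eqP; apply: contraT => /psiL[].
(* Centres where psi vanishes are dropped, so that each retained centre inherits the lower bound on
   its coordinates. *)
have [c0|c0] := eqVneq (psi c) 0.
  apply: IH => // x x0; have [d] := psiL x x0; rewrite in_cons => /predU1P[->|].
    by move=> /Npsi; rewrite c0 => /eqP; rewrite (negPf x0).
  by exists d.
pose psi' x := psi x - psi c * \prod_j wave R (c 0 j) N 0 (x 0 j).
have psi'E x : psi' x = if `[< box N c x >] then 0 else psi x.
  rewrite /psi' prod_wave_box; case: asboolP => [/Npsi ->|]; first by rewrite mulr1 subrr.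
  by rewrite mulr0 subr0.
have [x y xy|x|x|l lN psi'l] := IH psi'.
- rewrite !psi'E (Npsi _ _ xy).
  suff -> : `[< box N c y >] = `[< box N c x >] by [].
  apply/asboolP/asboolP => [cy|cx]; last exact: box_trans xy.
  by apply: box_trans cy _; exact: box_sym.
- by rewrite psi'E; case: ifP; [rewrite eqxx|move=> _; exact: psi0].
- rewrite psi'E; case: asboolP => [_|cx x0]; first by rewrite eqxx.
  have [d] := psiL x x0; rewrite in_cons => /predU1P[->//|].
  by exists d.
exists ((psi c, c) :: l).
  by move=> k; rewrite in_cons => /predU1P[-> j|/lN//]; exact: psi0.
by apply/funext => x; rewrite /comb big_cons /= -/(comb N l x) -psi'l /psi' addrC subrK.
Qed.

Lemma lizorkin_comb psi : lizorkin_psi psi -> exists N (l : seq (C * Qpn)),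
  (forall k, k \in l -> forall j, P ^ N < padic_abs (k.2 0 j)) /\ psi = comb N l.
Proof.
move=> /lizorkin_box[N [Npsi psi0 [L psiL]]].
by have [l lN ->] := box_comb Npsi psi0 psiL; exists N, l.
Qed.

Definition norm_mult (beta : 'I_n -> C) psi x : C :=
  \prod_j cpow (padic_norm R (x 0 j)) (beta j) * psi x.

(** Exact even on the hyperplanes: [cpow] is an exponential, hence invertible at base 0 too. *)
Lemma norm_multK beta psi : norm_mult beta (norm_mult (fun j => - beta j) psi) = psi.
Proof.
apply/funext => x; rewrite /norm_mult mulrA -big_split /= big1 ?mul1r// => j _.
by rewrite -cpowD subrr cpowx0.
Qed.

(** The multiplier fails to be locally constant only on the hyperplanes, near which psi vanishes;
    being nowhere 0, it leaves the support unchanged. *)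
Lemma lizorkin_norm_mult beta psi : lizorkin_psi psi ->
  lizorkin_psi (norm_mult beta psi).
Proof.
move=> Lpsi; have [N [Npsi psi0 _]] := lizorkin_box Lpsi.
have [[_ cpsi] psi00] := Lpsi.
split; last by move=> j x xj; rewrite /norm_mult (psi00 j)// mulr0.
split=> [x|].
  apply/nbhs_boxP; exists N => y xy /=; rewrite /norm_mult (Npsi _ _ xy).
  have [E|x0] := eqVneq (psi x) 0.
    by rewrite E; transitivity (0 : C); [exact: mulr0|exact/esym/mulr0].
  apply: (congr1 (fun u => u * psi x)); apply: eq_bigr => j _.
  suff yx : padic_abs (y 0 j) = padic_abs (x 0 j) by rewrite /padic_norm yx.
  by rewrite -[y 0 j](subrK (x 0 j)) padic_absDl// (le_lt_trans (xy j))// psi0.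
rewrite (_ : [set x | _] = [set x | psi x != 0])//.
apply/funext => x; rewrite /norm_mult /= mulf_eq0 negb_or.
suff -> : \prod_j cpow (padic_norm R (x 0 j)) (beta j) != 0 by [].
by apply/prodf_neq0 => j _; exact: cpow_neq0.
Qed.

(** The dilation seen before the Fourier transform; |t|^n is the Jacobian of x |-> t x. *)
Definition rescale (t : Qp) psi x : C := ((padic_norm R t) ^+ n)%:C * psi (t *: x).

Lemma box_scale (t : Qp) m N x y : padic_abs t = P ^ m -> box N x y ->
  box (N + m) (t *: x) (t *: y).
Proof.
move=> tm xy j; rewrite !mxE -mulrBr padic_absM tm expfzDr ?gt_eqF// mulrC.
by rewrite ler_pM2r ?exprz_gt0.
Qed.

Lemma continuous_scale (t : Qp) : t != 0 -> continuous (fun x : Qpn => t *: x).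
Proof.
move=> /padic_abs_exprz[m tm] x A /nbhs_boxP[N NA]; apply/nbhs_boxP.
by exists (N - m) => y /(box_scale tm); rewrite subrK => /NA.
Qed.

Lemma lizorkin_rescale t psi : t != 0 -> lizorkin_psi psi -> lizorkin_psi (rescale t psi).
Proof.
move=> t0 Lpsi; have [N [Npsi _ _]] := lizorkin_box Lpsi.
have [[_ cpsi] psi00] := Lpsi; have [m tm] := padic_abs_exprz t0.
split; last by move=> j x xj; rewrite /rescale (psi00 j) ?mulr0// mxE xj mulr0.
split=> [x|].
  apply/nbhs_boxP; exists (N - m) => y /(box_scale tm); rewrite subrK => /Npsi.
  by rewrite /rescale => ->.
have tV0 : t^-1 != 0 by rewrite invr_eq0.
have cK : compact [set t^-1 *: x | x in closure [set x | psi x != 0]].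
  apply: continuous_compact => //; apply: continuous_subspaceT.
  exact: continuous_scale.
apply: subclosed_compact cK _; first exact: closed_closure.
move=> x Sx; exists (t *: x); last by rewrite scalerA mulVf// scale1r.
move=> A tA; have [y [Sy Ay]] := Sx _ (continuous_scale t0 tA).
exists (t *: y); split=> //; move: Sy; rewrite /rescale /=.
by apply: contra_neq => ->; rewrite mulr0.
Qed.

End SeveralVariables.

(** * The multiplier identity, dilations, and transfer of the limit *)

Section FourierVladimirov.
Variables (R : realType) (p : nat) (p_pr : prime p) (n : nat).
Local Notation Qp := (padic p_pr).
Local Notation Qpn := 'rV[Qp]_n.
Local Notation C := (R[i]).
Local Notation P := (p%:R : rat).
Local Notation pR := (p%:R : R).
Variable mu : {measure set Qp -> \bar R}.
Hypothesis mu_haar : haar_measure mu.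
Local Open Scope complex_scope.
Implicit Types (m N : int) (x y c xi : Qpn) (psi : Qpn -> C).

Let P1 : 1 < P := ratP_gt1 p_pr.
Let P0 : 0 < P. Proof. exact: lt_trans P1. Qed.
Let pR0 : 0 < pR. Proof. by rewrite ltr0n prime_gt0. Qed.

Lemma waveE (x b z : Qp) N :
  wave R x N b z = if padic_abs (z - x) <= P ^ N then chi R (b * z) else 0.
Proof. by []. Qed.

Lemma padic_norm_Pz (t : Qp) m : padic_abs t = P ^ m -> padic_norm R t = pR ^ m.
Proof. by rewrite /padic_norm => ->; rewrite ratr_Pz. Qed.

Lemma padic_normE (t : Qp) : padic_norm R t = ratr (padic_abs t).
Proof. by []. Qed.

(* Otherwise unification unfolds these constants down to Cauchy sequences and
   real limits. *)
Local Opaque cpow chi wave padic_abs padic_norm.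

Lemma wave_shift (b x z : Qp) N : wave R 0 N b (x - z) = chi R (b * x) * wave R x N (- b) z.
Proof.
rewrite !waveE subr0.
have -> : padic_abs (x - z) = padic_abs (z - x) by rewrite -padic_absN opprB.
case: (padic_abs (z - x) <= P ^ N).
  by rewrite -chiD mulNr -mulrBr.
by rewrite (mulr0 (chi R (b * x))).
Qed.

Lemma linear_test1Z (T : (Qp -> C) -> C) (a : C) (f : Qp -> C) : linear_test1 T -> test1 f ->
  T (fun z => a * f z) = a * T f.
Proof.
move=> Tl tf; have := @linear_test1_sum _ _ _ T unit [:: tt] (fun=> a) (fun=> f) Tl.
rewrite big_seq1; under eq_fun do rewrite big_seq1.
exact.
Qed.

(** In each coordinate the centre of the ball becomes the frequency and the radius is inverted. *)
Lemma fourier_comb N (l : seq (C * Qpn)) : fourier mu (comb N l) =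
  (fun xi => \sum_(k <- l) k.1 *
    \prod_j ((pR ^ N)%:C * wave R 0 (- N) (k.2 0 j) (xi 0 j))).
Proof.
apply/funext => xi; rewrite /fourier /cintegraln.
transitivity (direct_product (fun=> cintegral mu setT) (fun x : Qpn =>
    \sum_(k <- l) k.1 * \prod_j wave R (k.2 0 j) N (xi 0 j) (x 0 j))).
  congr (direct_product _ _); apply/funext => x.
  rewrite additive_charE /comb mulr_sumr; apply: eq_bigr => k _.
  rewrite mulrCA -big_split; congr (_ * _); apply: eq_bigr => j _ /=.
  by rewrite !waveE mul0r chi0; case: ifP; rewrite ?mulr1 ?mulr0.
rewrite (direct_product_sum _ _ (u := fun (k : C * Qpn) j => wave R (k.2 0 j) N (xi 0 j))).
- apply: eq_bigr => k _; congr (_ * _); apply: eq_bigr => j _.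
  rewrite cintegral_wave// !waveE subr0 mulrC [k.2 0 j * _]mulrC.
  by rewrite -invr_expz -[_^-1]mul1r ler_pdivlMr ?exprz_gt0//; case: ifP; rewrite ?mul0r ?mulr0.
- by move=> j; exact: linear_cintegral.
- by move=> k j; exact: test1_wave.
Qed.

Lemma norm_mult_comb beta N (l : seq (C * Qpn)) :
  (forall k, k \in l -> forall j, P ^ N < padic_abs (k.2 0 j)) ->
  norm_mult beta (comb N l) =
  comb N [seq (k.1 * \prod_j cpow (padic_norm R (k.2 0 j)) (beta j), k.2) | k : C * Qpn <- l].
Proof.
move=> lN; apply/funext => x; rewrite /norm_mult /comb big_map mulr_sumr.
apply: eq_big_seq => k /lN kN; cbn [fst snd].
rewrite mulrCA -mulrA; apply: (congr1 ( *%R k.1)).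
rewrite -!big_split; apply: eq_bigr => j _; cbv beta.
have [xk|xk] := boolP (padic_abs (x 0 j - k.2 0 j) <= P ^ N); last first.
  by rewrite waveE (negPf xk) [LHS]mulr0 [RHS]mulr0.
suff -> : padic_norm R (x 0 j) = padic_norm R (k.2 0 j) by [].
by rewrite !padic_normE -[x 0 j](subrK (k.2 0 j)) padic_absDl// (le_lt_trans xk).
Qed.

Lemma vladimirov_fourier beta psi : lizorkin_psi psi ->
  vladimirov mu beta (fourier mu psi) = fourier mu (norm_mult beta psi).
Proof.
move=> /lizorkin_comb[N [l [lN ->]]].
rewrite norm_mult_comb// !fourier_comb; apply/funext => x.
rewrite big_map /vladimirov.
pose u (k : C * Qpn) j z : C :=
  (pR ^ N)%:C * chi R (k.2 0 j * x 0 j) * wave R (x 0 j) (- N) (- k.2 0 j) z.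
transitivity (direct_product (fun j => riesz_kernel mu (- beta j)) (fun xi : Qpn =>
    \sum_(k <- l) k.1 * \prod_j u k j (xi 0 j))).
  apply: (congr1 (direct_product _)); apply/funext => xi; apply: eq_bigr => k _.
  apply: (congr1 ( *%R k.1)); apply: eq_bigr => j _.
  by rewrite /u -mulrA -wave_shift !mxE.
rewrite direct_product_sum; first last.
- by move=> k j; apply: test1Z; exact: test1_wave.
- by move=> j; exact: linear_riesz.
apply: eq_big_seq => k /lN kN; cbn [fst snd].
rewrite -mulrA -big_split; apply: (congr1 ( *%R k.1)); apply: eq_bigr => j _; cbv beta.
have k0 : k.2 0 j != 0 by rewrite -padic_abs_gt0 (lt_trans _ (kN j))// exprz_gt0.
have [m km] := padic_abs_exprz k0.
rewrite linear_test1Z; [|exact: linear_riesz|exact: test1_wave].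
(* The centre bound p^N < |c_j| = p^m is the frequency condition -m < -N; the kernel of index
   -beta_j then returns p^(m beta_j) = |c_j|^(beta_j). *)
rewrite (@riesz_wave _ _ _ _ mu_haar _ _ _ _ (- m)) ?padic_absN ?opprK//; last first.
  by have := kN j; rewrite km ltr_eXz2l// ltrN2.
rewrite (padic_norm_Pz km) -(invr_expz pR m) cpowV ?exprz_gt0// cpowN invrK.
rewrite waveE subr0; case: (padic_abs (x 0 j) <= P ^ (- N)); first by rewrite [RHS]mulrC.
by rewrite [LHS]mulr0 (mulr0 (pR ^ N)%:C) [RHS]mulr0.
Qed.

Lemma fourier_rescale (t : Qp) psi : t != 0 -> lizorkin_psi psi ->
  fourier mu (rescale t psi) = (fun x => fourier mu psi (t^-1 *: x)).
Proof.
move=> t0 /lizorkin_comb[N [l [lN ->]]]; have [m tm] := padic_abs_exprz t0.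
have -> : rescale t (comb N l) =
    comb (N - m) [seq (((padic_norm R t) ^+ n)%:C * k.1, t^-1 *: k.2) | k : C * Qpn <- l].
  apply/funext => x; rewrite /rescale /comb big_map mulr_sumr.
  apply: eq_bigr => k _ /=; rewrite mulrA; congr (_ * _); apply: eq_bigr => j _.
  rewrite !waveE !mul0r !mxE.
  have -> : t * x 0 j - k.2 0 j = t * (x 0 j - t^-1 * k.2 0 j).
    by rewrite mulrBr mulVKf.
  by rewrite padic_absM tm mulrC -ler_pdivlMr ?exprz_gt0// invr_expz -expfzDr ?gt_eqF.
rewrite !fourier_comb; apply/funext => x; rewrite big_map.
apply: eq_bigr => k _; cbn [fst snd].
rewrite mulrAC mulrC; apply: (congr1 ( *%R k.1)).
(* The Jacobian gives one factor p^m per coordinate, compensating the volume p^(N-m) of the shrunken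
   ball. *)
have -> : (padic_norm R t ^+ n)%:C = \prod_(j < n) (pR ^ m)%:C.
  by rewrite prodr_const card_ord (padic_norm_Pz tm) rmorphXn.
rewrite -big_split; apply: eq_bigr => j _ /=.
have pNm : (pR ^ m)%:C * (pR ^ (N - m))%:C = (pR ^ N)%:C.
  by rewrite -rmorphM -expfzDr ?gt_eqF// addrC subrK.
rewrite mulrA pNm; apply: (congr1 ( *%R (pR ^ N)%:C)).
rewrite !waveE !subr0 !mxE mulrA [k.2 0 j * _]mulrC.
suff -> : (padic_abs (x 0 j) <= P ^ (- (N - m))) = (padic_abs (t^-1 * x 0 j) <= P ^ (- N)) by [].
by rewrite padic_absM padic_absV tm mulrC ler_pdivrMr ?exprz_gt0// -expfzDr ?gt_eqF// opprB addrC.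
Qed.

Lemma fourierZ (a : C) psi : lizorkin_psi psi ->
  fourier mu (fun x => a * psi x) = (fun x => a * fourier mu psi x).
Proof.
move=> /lizorkin_comb[N [l [_ ->]]].
have -> : (fun x => a * comb N l x) = comb N [seq (a * k.1, k.2) | k : C * Qpn <- l].
  apply/funext => x; rewrite /comb big_map mulr_sumr.
  by apply: eq_bigr => k _; rewrite mulrA.
rewrite !fourier_comb; apply/funext => x; rewrite big_map mulr_sumr.
by apply: eq_bigr => k _; rewrite mulrA.
Qed.

Lemma norm_mult_rescale beta (t : Qp) psi : t != 0 -> lizorkin_psi psi ->
  norm_mult beta (rescale t psi) =
  (fun x => cpow (padic_norm R t) (- \sum_j beta j) * rescale t (norm_mult beta psi) x).
Proof.
move=> t0 [_ psi0]; have [m tm] := padic_abs_exprz t0.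
apply/funext => x; rewrite /norm_mult /rescale.
(* On a hyperplane |t x_j|^beta does not factor, since [cpow] is 1 at base 0; there both sides
   vanish with psi. *)
have [/existsP[j /eqP xj]|/existsPn x0] := boolP [exists j, x 0 j == 0].
  have -> : psi (t *: x) = 0 by rewrite (psi0 j)// mxE xj mulr0.
  by rewrite [_ * 0]mulr0 [LHS]mulr0 [_ * 0]mulr0 [_ * 0]mulr0 [RHS]mulr0.
have -> : \prod_j cpow (padic_norm R (x 0 j)) (beta j) =
    cpow (padic_norm R t) (- \sum_j beta j) *
    \prod_j cpow (padic_norm R ((t *: x) 0 j)) (beta j).
  rewrite cpowN cpow_sum -prodfV -big_split; apply: eq_bigr => j _; cbv beta.
  have [k xk] := padic_abs_exprz (x0 j).
  have nt : padic_norm R (t * x 0 j) = padic_norm R t * padic_norm R (x 0 j).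
    by rewrite !padic_normE padic_absM rmorphM.
  rewrite mxE nt cpowM ?(padic_norm_Pz tm) ?(padic_norm_Pz xk) ?exprz_gt0//.
  by apply/esym; apply: mulKf; exact: cpow_neq0.
have E (a b c d : C) : (a * b) * (c * d) = a * (c * (b * d)) by ring.
exact: E.
Qed.

Lemma lizorkin_phi_vladimirov beta phi : lizorkin_phi mu phi ->
  lizorkin_phi mu (vladimirov mu (n := n) beta phi).
Proof.
move=> [psi Lpsi ->]; exists (norm_mult beta psi); first exact: lizorkin_norm_mult.
exact: vladimirov_fourier.
Qed.

Lemma vladimirov_surj beta phi : lizorkin_phi mu phi ->
  exists2 phi' , lizorkin_phi mu phi' & vladimirov mu (n := n) beta phi' = phi.
Proof.
move=> [psi Lpsi ->]; have Lpsi' := lizorkin_norm_mult (fun j => - beta j) Lpsi.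
exists (fourier mu (norm_mult (fun j => - beta j) psi)); first by exists (norm_mult (fun j => - beta j) psi).
by rewrite vladimirov_fourier// norm_multK.
Qed.

Lemma vladimirov_dilation beta (t : Qp) phi : t != 0 -> lizorkin_phi mu phi ->
  vladimirov mu beta (fun x : Qpn => phi (t^-1 *: x)) =
  (fun x => cpow (padic_norm R t) (- \sum_j beta j) * vladimirov mu beta phi (t^-1 *: x)).
Proof.
move=> t0 [psi Lpsi ->]; have Lm := lizorkin_norm_mult beta Lpsi.
rewrite -fourier_rescale// vladimirov_fourier; last exact: lizorkin_rescale.
rewrite norm_mult_rescale// fourierZ; last exact: lizorkin_rescale.
by rewrite fourier_rescale// vladimirov_fourier.
Qed.

Lemma lizorkin_phi_dilation (t : Qp) (phi : Qpn -> C) : t != 0 -> lizorkin_phi mu phi ->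
  lizorkin_phi mu (fun x => phi (t^-1 *: x)).
Proof.
move=> t0 [psi Lpsi ->]; exists (rescale t psi); first exact: lizorkin_rescale.
by rewrite fourier_rescale.
Qed.

Lemma lizorkin_dualZ (f : (Qpn -> C) -> C) (a : C) phi : lizorkin_dual mu f ->
  lizorkin_phi mu phi -> f (fun x => a * phi x) = a * f phi.
Proof.
(* Linearity is stated for c phi1 + phi2, so a phi is written as (a - 1) phi + phi. *)
move=> fl Lphi; have := fl (a - 1) _ _ Lphi Lphi.
rewrite -[X in _ * _ + X]mul1r -mulrDl subrK => <-; congr (f _).
by apply/funext => x; rewrite -[X in _ = _ + X]mul1r -mulrDl subrK.
Qed.

Lemma dilation_dual_vladimirov beta (f : (Qpn -> C) -> C) (t : Qp) phi :
  lizorkin_dual mu f -> t != 0 -> lizorkin_phi mu phi ->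
  dilation t (dual_vladimirov mu beta f) phi =
  cpow (padic_norm R t) (- \sum_j beta j) * dilation t f (vladimirov mu beta phi).
Proof.
move=> fl t0 Lphi; rewrite /dilation /dual_vladimirov vladimirov_dilation//.
rewrite lizorkin_dualZ//; last first.
  by apply: lizorkin_phi_dilation => //; exact: lizorkin_phi_vladimirov.
by rewrite mulrCA.
Qed.

Lemma padic_infty_filter : Filter (@padic_infty p p_pr).
Proof.
apply: filter_from_filter; first by exists 0.
move=> M M' _ _; exists (Num.max M M') => // t.
by rewrite /= gt_max => /andP[].
Qed.

Lemma quasi_limit_vladimirov beta (f : (Qpn -> C) -> C) (rho : Qp -> C) (a : C) phi :
  lizorkin_dual mu f -> lizorkin_phi mu phi ->
  ((dilation t (dual_vladimirov mu beta f) phi /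
    (cpow (padic_norm R t) (- \sum_j beta j) * rho t) : C^o)
      @[t --> (@padic_infty p p_pr)] --> (a : C^o)) =
  ((dilation t f (vladimirov mu beta phi) / rho t : C^o)
      @[t --> (@padic_infty p p_pr)] --> (a : C^o)).
Proof.
move=> fl Lphi; have FF := padic_infty_filter.
have E : {near @padic_infty p p_pr, (fun t => dilation t (dual_vladimirov mu beta f) phi /
    (cpow (padic_norm R t) (- \sum_j beta j) * rho t) : C^o) =1
    (fun t => dilation t f (vladimirov mu beta phi) / rho t : C^o)}.
  (* Threshold 0 in the filter already ensures that t is nonzero, where the two quotients
     coincide. *)
  exists 0 => // t /=; rewrite padic_abs_gt0 => t0.
  by rewrite dilation_dual_vladimirov// -mulf_div mulfV ?mul1r// cpow_neq0.
apply/propext; split; apply: cvg_trans; apply: near_eq_cvg => //.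
by apply: filterS E => t ->.
Qed.

End FourierVladimirov.

Theorem theorem7p2 (R : realType) (p : nat) (p_pr : prime p)
    (mu : {measure set (padic p_pr) -> \bar R}) (mu_haar : haar_measure mu)
    (n : nat) (n_ge1 : (1 <= n)%N)
    (f g : ('rV[padic p_pr]_n -> R[i]) -> R[i])
    (f_dual : lizorkin_dual mu f) (g_dual : lizorkin_dual mu g)
    (rho : padic p_pr -> R[i]) (rho_automodel : automodel rho)
    (beta : 'I_n -> R[i]) :
  quasi_asymptotics mu f g rho <->
  quasi_asymptotics mu (dual_vladimirov mu beta f) (dual_vladimirov mu beta g)
    (fun t => cpow (padic_norm R t) (- \sum_j beta j) * rho t).
Proof.
split=> -[[phi Lphi gphi] lim]; split.
(* Surjectivity turns a witness that g is nonzero into one for its image. *)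
- have [phi' Lphi' E] := vladimirov_surj mu_haar beta Lphi.
  by exists phi'; rewrite // /dual_vladimirov E.
- move=> phi' Lphi'; rewrite quasi_limit_vladimirov//.
  exact/lim/lizorkin_phi_vladimirov.
- by exists (vladimirov mu beta phi) => //; exact: lizorkin_phi_vladimirov.
(* The hypothesis speaks of f only on images of the operator; surjectivity makes these all test
   functions. *)
- move=> phi' /(vladimirov_surj mu_haar beta)[phi'' Lphi'' <-].
  by rewrite -quasi_limit_vladimirov//; exact: lim.
Qed.
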